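(* Let $\mathcal{M}'_m$ (resp. $\mathcal{M}''_m$) be a meridian surface of elliptic (resp. hyperbolic) type in $\mathbb{R}^4_1$ from the general class. (i) $\mathcal{M}'_m$ has parallel normal bundle if and only if one of the following cases holds: (a) the meridian $m$ is defined by $$f(u)=\pm\sqrt{u^2+2cu+d},\qquad g(u)=\pm\sqrt{c^2-d}\,\ln\left|u+c+\sqrt{u^2+2cu+d}\right|+a,$$ where $a$, $c$ and $d$ are constants, $c^2>d$; (b) the spherical curve on $S^2(1)$ defining $\mathcal{M}'_m$ has constant spherical curvature $\kappa=\mathrm{const}=b$, $b\neq0$, and the meridian $m$ is determined by $\dot f=y(f)$, where $$y(t)=\pm\frac{\sqrt{(a^2+1)\,t^2+2ac\,t+c^2}}{t},\qquad a=\mathrm{const}\neq0,\quad c=\mathrm{const},$$ and $g(u)$ is defined by $\dot g(u)=\sqrt{\dot f^2(u)-1}$. (ii) $\mathcal{M}''_m$ has parallel normal bundle if and only if one of the following cases holds: (a) the meridian $m$ is defined by $$f(u)=\pm\sqrt{u^2+2cu+d},\qquad g(u)=\pm\sqrt{d-c^2}\,\ln\left|u+c+\sqrt{u^2+2cu+d}\right|+a,$$ where $a$, $c$ and $d$ are constants, $d>c^2$; (b) the curve on $S^2_1(1)$ defining $\mathcal{M}''_m$ has constant spherical curvature $\kappa=\mathrm{const}=b$, $b\neq0$, and the meridian $m$ is determined by $\dot f=y(f)$, where $$y(t)=\pm\frac{\sqrt{(1-a^2)\,t^2+2ac\,t-c^2}}{t},\qquad a=\mathrm{const}\neq0,\quad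 c=\mathrm{const},$$ and $g(u)$ is defined by $\dot g(u)=\sqrt{1-\dot f^2(u)}$.
   Context: $\mathbb{R}^4_1$ is Minkowski 4-space with metric $\langle\cdot,\cdot\rangle$ of signature $(3,1)$ and orthonormal basis $e_1,e_2,e_3,e_4$, $\langle e_i,e_i\rangle=1$ for $i=1,2,3$, $\langle e_4,e_4\rangle=-1$. Dots denote $d/du$; $I,J\subset\mathbb{R}$ are intervals; all functions are smooth. Meridian surface of elliptic type: $\mathcal{M}'_m: z(u,v)=f(u)\,l(v)+g(u)\,e_4$, $u\in I$, $v\in J$, where $f>0$, $\dot f^2-\dot g^2=1$, and $l=l(v)$ is a smooth curve parameterized by arc length ($\langle l',l'\rangle=1$) on the unit sphere $S^2(1)$ centered at the origin of the Euclidean space $\mathrm{span}\{e_1,e_2,e_3\}$. Put $t=l'$ and let $n$ be a smooth unit vector field with $\{l,t,n\}$ an orthonormal frame of $\mathrm{span}\{e_1,e_2,e_3\}$; the spherical curvature of the curve $l(v)$ is $\kappa(v)=\langle t'(v),n(v)\rangle$. Meridian surface of hyperbolic type: $\mathcal{M}''_m: z(u,v)=f(u)\,l(v)+g(u)\,e_1$, $u\in I$, $v\in J$, where $f>0$, $\dot f^2+\dot g^2=1$, and $l=l(v)$ is a smooth curve with $\langle l',l'\rangle=1$ on the de Sitter space $S^2_1(1)=\{V:\langle V,V\rangle=1\}$ in $\mathrm{span}\{e_2,e_3,e_4\}$. Put $t=l'$ and let $n$ be a smooth vector field with $\langle n,n\rangle=-1$ and $\{l,t,n\}$ an orthonormal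 frame of $\mathrm{span}\{e_2,e_3,e_4\}$; the spherical curvature of the curve $l(v)$ is $\kappa(v)=\langle t'(v),n(v)\rangle$. Both are spacelike surfaces (the induced metric is Riemannian). The curve $m:u\mapsto(f(u),g(u))$ is the meridian curve, with curvature $\kappa_m=\dot f\ddot g-\dot g\ddot f$. The sign of $\dot g$ is normalized so that $\dot g=\sqrt{\dot f^2-1}$ in the elliptic case and $\dot g=\sqrt{1-\dot f^2}$ in the hyperbolic case. The surface is from the general class if $\kappa_m(u)\,\kappa(v)\neq0$ for all $u,v$. It is also assumed that the mean curvature vector field $H=\frac12\mathrm{tr}\,\sigma$ ($\sigma$ the second fundamental tensor) satisfies $\langle H,H\rangle\neq0$ everywhere. Parallel normal bundle: let $\{b,l\}$ be the geometric normal frame, i.e. the orthonormal frame of the normal bundle with $b$ collinear with $H$ (here $b,l$ are normal vector fields, not the constant $b$ and curve $l(v)$ above), and let $D$ be the normal connection. The surface has parallel normal bundle if $D_xb=0$ and $D_xl=0$ for every tangent vector field $x$. Equivalently, $\beta_1=\beta_2=0$, where $\beta_1=\langle\nabla'_xb,l\rangle$, $\beta_2=\langle\nabla'_yb,l\rangle$, $\nabla'$ is the flat connection of $\mathbb{R}^4_1$, $x=(X+Y)/\sqrt2$, $y=(-X+Y)/\sqrt2$, $X=z_u$, $Y=z_v/f$. ''Determined by $\dot f=y(f)$'' means $\dot f(u)=y(f(u))$.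
   Formalization: In (ii)(b) the sign ± in f'=y(f) may depend on u: f' can vanish and change sign at equal values of f, so with a single-valued y the equivalence is false. The intervals I, J are taken open and nonempty. *)

(* Defs.v *)
From HB Require Import structures.
From mathcomp Require Import all_boot all_order all_algebra.
From mathcomp Require Import all_classical all_reals all_analysis.

Set Implicit Arguments.
Unset Strict Implicit.
Unset Printing Implicit Defensive.

Import Order.TTheory GRing.Theory Num.Theory.
Import numFieldNormedType.Exports.

Local Open Scope ring_scope.
Local Open Scope classical_set_scope.

Section Smooth.
Context {R : realType} {V W : normedModType R}.

(* iter_derive [:: v1; ...; vk] F = 'D_v1 (... ('D_vk F)) *)
Fixpoint iter_derive (vs : seq V) (F : V -> W) : V -> W :=
  if vs is v :: vs' then fun x => 'D_v (iter_derive vs' F) x else F.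

(* C^infty on A (used with A open and V finite-dimensional): all iterated
   directional derivatives exist and are Frechet differentiable on A. *)
Definition smooth_on (A : set V) (F : V -> W) : Prop :=
  forall (vs : seq V) (x : V), A x -> differentiable (iter_derive vs F) x.

End Smooth.

Section Minkowski.
Context {R : realType}.

(* e_ 1, ..., e_ 4 is the standard basis (1-based indices). *)
Definition e_ (k : nat) : 'rV[R]_4 := \row_(j < 4) (j.+1 == k)%:R.

Definition mink (x y : 'rV[R]_4) : R :=
  \sum_(i < 4) (-1) ^+ (i == 3%N :> nat) * (x 0 i * y 0 i).

Definition in_span3 (i j k : nat) (x : 'rV[R]_4) : Prop :=
  (x <= e_ i + e_ j + e_ k)%MS.

Definition sphere2 : set 'rV[R]_4 :=
  [set x | in_span3 1 2 3 x /\ mink x x = 1].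

Definition deSitter2 : set 'rV[R]_4 :=
  [set x | in_span3 2 3 4 x /\ mink x x = 1].

(* x, y, w are pairwise orthogonal with <x,x> = <y,y> = 1, <w,w> = eps;
   such vectors are automatically linearly independent when eps <> 0. *)
Definition orthonormal3 (eps : R) (x y w : 'rV[R]_4) : Prop :=
  [/\ mink x x = 1, mink y y = 1 & mink w w = eps] /\
  [/\ mink x y = 0, mink x w = 0 & mink y w = 0].

End Minkowski.

(* Geometry of a parametrized surface z with nondegenerate induced metric.
   A pair w : R * R encodes the tangent vector dz(w) = w.1 z_u + w.2 z_v, so
   that the flat derivative of a field xi along dz(w) is 'D_w xi. *)
Section Surface.
Context {R : realType}.
Implicit Types (z xi b eta : R * R -> 'rV[R]_4) (p w : R * R).

Definition z_u z p : 'rV[R]_4 := 'D_((1, 0) : R * R) z p.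
Definition z_v z p : 'rV[R]_4 := 'D_((0, 1) : R * R) z p.

Definition EE z p : R := mink (z_u z p) (z_u z p).
Definition FF z p : R := mink (z_u z p) (z_v z p).
Definition GG z p : R := mink (z_v z p) (z_v z p).

Definition tangent_part z p (x : 'rV[R]_4) : 'rV[R]_4 :=
  (EE z p * GG z p - FF z p ^+ 2)^-1 *:
  ((GG z p * mink x (z_u z p) - FF z p * mink x (z_v z p)) *: z_u z p +
   (EE z p * mink x (z_v z p) - FF z p * mink x (z_u z p)) *: z_v z p).

Definition normal_part z p (x : 'rV[R]_4) : 'rV[R]_4 := x - tangent_part z p x.

Definition is_normal z p (x : 'rV[R]_4) : Prop :=
  mink x (z_u z p) = 0 /\ mink x (z_v z p) = 0.

(* second fundamental tensor sigma(dz(w1), dz(w2)) *)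
Definition sff z p w1 w2 : 'rV[R]_4 :=
  normal_part z p ('D_w1 (fun q => 'D_w2 z q) p).

(* one half of the trace of sigma with respect to the induced metric *)
Definition mean_curvature z p : 'rV[R]_4 :=
  (2 * (EE z p * GG z p - FF z p ^+ 2))^-1 *:
  (GG z p *: sff z p (1, 0) (1, 0) - (2 * FF z p) *: sff z p (1, 0) (0, 1)
   + EE z p *: sff z p (0, 1) (0, 1)).

(* D_x xi for the tangent vector field x = dz(w) *)
Definition normal_connection z (w : R * R -> R * R) xi p : 'rV[R]_4 :=
  normal_part z p ('D_(w p) xi p).

Definition parallel_section (A : set (R * R)) z xi : Prop :=
  forall w : R * R -> R * R, smooth_on A w ->
  forall p, A p -> normal_connection z w xi p = 0.

(* The normal bundle has signature (1,1), hence the opposite signs. *)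
Definition geometric_normal_frame (A : set (R * R)) z b eta : Prop :=
  [/\ smooth_on A b, smooth_on A eta &
   forall p, A p ->
   [/\ is_normal z p (b p) /\ is_normal z p (eta p),
       `|mink (b p) (b p)| = 1 /\ mink (eta p) (eta p) = - mink (b p) (b p),
       mink (b p) (eta p) = 0 &
       exists k : R, mean_curvature z p = k *: b p]].

Definition parallel_normal_bundle (A : set (R * R)) z : Prop :=
  exists b eta, [/\ geometric_normal_frame A z b eta,
    parallel_section A z b & parallel_section A z eta].

End Surface.

Section Meridian.
Context {R : realType}.
Implicit Types (I J : set R) (f g : R -> R) (l n : R -> 'rV[R]_4).

Definition open_interval I : Prop := [/\ open I, is_interval I & I !=set0].

Definition meridian_curvature f g (u : R) : R :=
  derive1 f u * derive1 (derive1 g) u - derive1 g u * derive1 (derive1 f) u.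

Definition spherical_curvature l n (v : R) : R :=
  mink (derive1 (derive1 l) v) (n v).

Definition elliptic_surface f g l (p : R * R) : 'rV[R]_4 :=
  f p.1 *: l p.2 + g p.1 *: e_ 4.

Definition hyperbolic_surface f g l (p : R * R) : 'rV[R]_4 :=
  f p.1 *: l p.2 + g p.1 *: e_ 1.

Record elliptic_data I J f g l n : Prop := EllipticData {
  ell_I : open_interval I;
  ell_J : open_interval J;
  ell_f : smooth_on I f;
  ell_g : smooth_on I g;
  ell_l : smooth_on J l;
  ell_n : smooth_on J n;
  ell_f_gt0 : forall u, I u -> 0 < f u;
  ell_unit : forall u, I u -> derive1 f u ^+ 2 - derive1 g u ^+ 2 = 1;
  ell_sign : forall u, I u -> derive1 g u = Num.sqrt (derive1 f u ^+ 2 - 1);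
  ell_sphere : forall v, J v -> sphere2 (l v);
  ell_arclength : forall v, J v -> mink (derive1 l v) (derive1 l v) = 1;
  ell_n_span : forall v, J v -> in_span3 1 2 3 (n v);
  ell_frame : forall v, J v -> orthonormal3 1 (l v) (derive1 l v) (n v) }.

Record hyperbolic_data I J f g l n : Prop := HyperbolicData {
  hyp_I : open_interval I;
  hyp_J : open_interval J;
  hyp_f : smooth_on I f;
  hyp_g : smooth_on I g;
  hyp_l : smooth_on J l;
  hyp_n : smooth_on J n;
  hyp_f_gt0 : forall u, I u -> 0 < f u;
  hyp_unit : forall u, I u -> derive1 f u ^+ 2 + derive1 g u ^+ 2 = 1;
  hyp_sign : forall u, I u -> derive1 g u = Num.sqrt (1 - derive1 f u ^+ 2);
  hyp_deSitter : forall v, J v -> deSitter2 (l v);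
  hyp_arclength : forall v, J v -> mink (derive1 l v) (derive1 l v) = 1;
  hyp_n_span : forall v, J v -> in_span3 2 3 4 (n v);
  hyp_frame : forall v, J v -> orthonormal3 (-1) (l v) (derive1 l v) (n v) }.

Definition general_class I J f g l n : Prop :=
  forall u v, I u -> J v ->
  meridian_curvature f g u * spherical_curvature l n v != 0.

Definition non_null_mean_curvature (A : set (R * R))
    (z : R * R -> 'rV[R]_4) : Prop :=
  forall p, A p -> mink (mean_curvature z p) (mean_curvature z p) != 0.

Definition const_spherical_curvature J l n : Prop :=
  exists b : R, b != 0 /\ forall v, J v -> spherical_curvature l n v = b.

(* Here and below (-1) ^+ s with s : bool stands for a choice of sign. *)
Definition elliptic_case_a I f g : Prop :=
  exists (a c d : R) (s1 s2 : bool), d < c ^+ 2 /\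
  forall u, I u -> let r := Num.sqrt (u ^+ 2 + 2 * c * u + d) in
    [/\ 0 <= u ^+ 2 + 2 * c * u + d,
        f u = (-1) ^+ s1 * r &
        g u = (-1) ^+ s2 * Num.sqrt (c ^+ 2 - d) * ln `|u + c + r| + a].

Definition hyperbolic_case_a I f g : Prop :=
  exists (a c d : R) (s1 s2 : bool), c ^+ 2 < d /\
  forall u, I u -> let r := Num.sqrt (u ^+ 2 + 2 * c * u + d) in
    [/\ 0 <= u ^+ 2 + 2 * c * u + d,
        f u = (-1) ^+ s1 * r &
        g u = (-1) ^+ s2 * Num.sqrt (d - c ^+ 2) * ln `|u + c + r| + a].

Definition elliptic_radicand (a c t : R) : R :=
  (a ^+ 2 + 1) * t ^+ 2 + 2 * a * c * t + c ^+ 2.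

Definition elliptic_case_b I J f g l n : Prop :=
  const_spherical_curvature J l n /\
  exists (a c : R) (s : bool), a != 0 /\
  forall u, I u ->
    [/\ 0 <= elliptic_radicand a c (f u),
        derive1 f u =
          (-1) ^+ s * (Num.sqrt (elliptic_radicand a c (f u)) / f u) &
        derive1 g u = Num.sqrt (derive1 f u ^+ 2 - 1)].

Definition hyperbolic_radicand (a c t : R) : R :=
  (1 - a ^+ 2) * t ^+ 2 + 2 * a * c * t - c ^+ 2.

(* In the hyperbolic case f' may change sign at a turning point of f, so the
   branch of the ODE f' = +- sqrt(..)/f is allowed to depend on u.  (In the
   elliptic case |f'| >= 1 and the sign is constant.) *)
Definition hyperbolic_case_b I J f g l n : Prop :=
  const_spherical_curvature J l n /\
  exists (a c : R) (s : R -> bool), a != 0 /\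
  forall u, I u ->
    [/\ 0 <= hyperbolic_radicand a c (f u),
        derive1 f u =
          (-1) ^+ s u * (Num.sqrt (hyperbolic_radicand a c (f u)) / f u) &
        derive1 g u = Num.sqrt (1 - derive1 f u ^+ 2)].

End Meridian.

(* Main.v *)
Require Import Defs.
From HB Require Import structures.
From mathcomp Require Import all_boot all_order all_algebra.
From mathcomp Require Import all_classical all_reals all_analysis.
From mathcomp Require Import ring lra.
Import Order.TTheory GRing.Theory Num.Theory.
Import numFieldNormedType.Exports.
Local Open Scope ring_scope.
Local Open Scope classical_set_scope.

(** The elliptic and the hyperbolic surfaces are treated together.  Let eps be 1
in the elliptic and -1 in the hyperbolic case and let e be the axis, so that
<e,e> = -eps, <n,n> = eps, f'^2 - eps g'^2 = 1 and z = f l + g e.  Besides n, the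
normal bundle is spanned by the axial normal n2 = eps g' l + f' e, with
<n2,n2> = -eps.

The frame {n, n2} is always parallel: flat derivatives of n and n2 are
combinations of z_u and t (is_derive_spherical_normal, is_derive_axial_normal).
Hence a normal field is parallel iff its coordinates in that frame are constant.
The mean curvature vector is H = (eps kappa n + A n2) / (2 f), where
A = g' + f km depends on u only and kappa on v only (mean_curvatureE).  As kappa
does not vanish, a parallel unit field collinear with H exists iff A(u) / kappa(v)
is constant on I x J, that is, iff A = 0, or kappa and A are nonzero constants
(parallel_normal_bundleP).

It remains to integrate these two equations for the meridian.  Since
f'' = eps g' km and g'' = f' km, one has (f f')' = 1 + eps g' A and
(f g')' = f' A.
- A = 0 says that (f f')' = 1, so f^2 is a monic quadratic polynomial in u, and
  g' is a constant over f, whose primitive is the logarithm of case (a).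
- A = a says that f g' - a f is constant, and f' is then recovered from
  f'^2 = 1 + eps g'^2, which is the differential equation of case (b).

The converse in case (b) starts from the square (f g')^2 = (a f + eps c)^2 and
has to choose a root.  The sign convention g' >= 0 and km <> 0 force g' > 0, so
a f + eps c never vanishes and one sign works on all of I.  Differentiating gives
(A - (+-a)) f' = 0; where f' vanishes, a further derivative gives A = +-a, because
f'' = eps g' km is nonzero there (affine_profile).

The remaining work is the smoothness of the fields a n + b n2: they belong to
the class of sums of fields phi(u) psi(v), which consists of differentiable fields
and is stable under directional derivatives. *)

(** * Calculus on intervals and rectangles *)

Section Calculus.
Context {R : realType}.
Implicit Types (I J : set R) (h : R -> R).

Lemma smooth_differentiable {V W : normedModType R} (A : set V) (F : V -> W) x :
  smooth_on A F -> A x -> differentiable F x.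
Proof. by move=> sF Ax; exact: (sF [::]). Qed.

Lemma smooth_derive1 {W : normedModType R} (A : set R) (F : R -> W) :
  smooth_on A F -> smooth_on A (derive1 F).
Proof.
move=> sF vs x Ax.
suff -> : iter_derive vs (derive1 F) = iter_derive (rcons vs 1) F by exact: sF.
elim: vs {x Ax} => [|v vs IH] /=; last by rewrite IH.
by apply/funext => x; rewrite derive1E.
Qed.

Lemma smooth_is_derive {W : normedModType R} (A : set R) (F : R -> W) x :
  smooth_on A F -> A x -> is_derive x (1 : R) F (derive1 F x).
Proof.
move=> sF Ax; rewrite derive1E; apply/derivableP/derivable1_diffP.
exact: smooth_differentiable sF Ax.
Qed.

Lemma is_derive_derive1 {W : normedModType R} (F : R -> W) x dF :
  is_derive x (1 : R) F dF -> derive1 F x = dF.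
Proof. by move=> ?; rewrite derive1E derive_val. Qed.

Lemma is_derive_cst_on {V W : normedModType R} (A : set V) (F : V -> W) c x v dF :
  open A -> A x -> (forall y, A y -> F y = c) -> is_derive x v F dF -> dF = 0.
Proof.
move=> oA Ax Fc dFx; rewrite -(@derive_val _ _ _ _ _ _ _ dFx) -(derive_cst c x v).
by apply: near_eq_derive; apply: filterS (open_nbhs_nbhs (conj oA Ax)) => y /Fc.
Qed.

Lemma zero_derive_interval_cst I h : is_interval I ->
  (forall x, I x -> is_derive x (1 : R) h 0) -> forall x y, I x -> I y -> h x = h y.
Proof.
move=> itvI dh x y Ix Iy; wlog xy : x y Ix Iy / x <= y.
  by move=> H; case: (leP x y) => [/H->//|/ltW/H->].
have inI z : z \in `[x, y]%R -> I z.
  by rewrite in_itv /= => xzy; exact: itvI Ix Iy _ xzy.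
rewrite -(subKr (h y) (h x)).
have ch : {within `[x, y], continuous h}.
  by apply: derivable_within_continuous => z /inI/dh dz; exact: ex_derive.
have dh0 z : z \in `]x, y[%R -> is_derive z (1 : R) h (cst 0 z).
  by move=> zxy; apply/dh/inI; exact: subset_itv_oo_cc.
have [z _] := MVT_segment xy dh0 ch.
by rewrite mul0r => ->; rewrite subr0.
Qed.

Lemma eq_is_derive_cst I h1 h2 dh : is_interval I ->
  (forall x, I x -> is_derive x (1 : R) h1 (dh x)) ->
  (forall x, I x -> is_derive x (1 : R) h2 (dh x)) ->
  I !=set0 -> exists c, forall x, I x -> h1 x = h2 x + c.
Proof.
move=> itvI dh1 dh2 [x0 Ix0]; exists (h1 x0 - h2 x0) => x Ix.
suff: (h1 - h2) x = (h1 - h2) x0.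
  by rewrite -[LHS]/(h1 x - h2 x) -[RHS]/(h1 x0 - h2 x0) => <-; rewrite subrKC.
apply: (@zero_derive_interval_cst I) => // y Iy; rewrite -(subrr (dh y)).
by apply: is_deriveB; [exact: dh1|exact: dh2].
Qed.

(** The sign is given as a boolean s so that it can be used directly in
products with a power of -1. *)
Lemma interval_sign_cst I h : is_interval I ->
  (forall x, I x -> derivable h x 1) -> (forall x, I x -> h x != 0) ->
  I !=set0 -> exists s : bool, forall x, I x -> h x = (-1) ^+ s * `|h x|.
Proof.
move=> itvI dh h0 [x0 Ix0].
have step x y : I x -> I y -> x <= y -> h x * h y < 0 -> False.
  move=> Ix Iy xy hxy.
  have inI z : z \in `[x, y]%R -> I z.
    by rewrite in_itv /= => xzy; exact: itvI Ix Iy _ xzy.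
  have ch : {within `[x, y], continuous h}.
    by apply: derivable_within_continuous => z /inI/dh.
  have [|z /inI Iz hz] := @IVT R h x y 0 xy ch.
    rewrite minEle maxEle; move: (h0 _ Ix) (h0 _ Iy) hxy.
    by case: (leP (h x) (h y)) => ? ? ? ?; apply/andP; split; nra.
  by move: (h0 _ Iz); rewrite hz eqxx.
have same x y : I x -> I y -> 0 < h x * h y.
  move=> Ix Iy; have : h x * h y != 0 by rewrite mulf_neq0 ?h0.
  rewrite neq_lt => /orP[neg|//]; exfalso; case: (leP x y) => [xy|/ltW yx].
    exact: (step x y).
  by apply: (step y x) => //; rewrite mulrC.
have [pos|neg] := ltP 0 (h x0).
- exists false => x Ix; rewrite mul1r ger0_norm //.
  by have := same _ _ Ix0 Ix; nra.
- exists true => x Ix; rewrite expr1 mulN1r ler0_norm ?opprK //.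
  by have := same _ _ Ix0 Ix; have := h0 _ Ix0; nra.
Qed.

Lemma is_derive_mxP {V : normedModType R} {m n : nat} (M : V -> 'M[R]_(m, n)) p w dM :
  is_derive p w M dM <->
  (forall i j, is_derive p w (fun q => M q i j) (dM i j)).
Proof.
split=> [[dM1 <-] i j|H].
  apply: DeriveDef; first by move/derivable_mxP : dM1 => /(_ i j).
  by rewrite derive_mx // mxE.
have dM1 : derivable M p w by apply/derivable_mxP => i j; case: (H i j).
apply: DeriveDef => //; rewrite derive_mx //; apply/matrixP => i j.
by rewrite mxE derive_val.
Qed.

Lemma is_derive_fst {W : normedModType R} (F : R -> W) (p w : R * R) :
  differentiable F p.1 ->
  is_derive p w (fun q => F q.1) (w.1 *: derive1 F p.1).
Proof.
move=> dF; have dw := @diff_derivable _ _ _ F p.1 w.1 dF.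
apply: DeriveDef => //; transitivity ('D_(w.1) F p.1); first by [].
by rewrite deriveE // diff1E.
Qed.

Lemma is_derive_snd {W : normedModType R} (F : R -> W) (p w : R * R) :
  differentiable F p.2 ->
  is_derive p w (fun q => F q.2) (w.2 *: derive1 F p.2).
Proof.
move=> dF; have dw := @diff_derivable _ _ _ F p.2 w.2 dF.
apply: DeriveDef => //; transitivity ('D_(w.2) F p.2); first by [].
by rewrite deriveE // diff1E.
Qed.

(** Partial derivatives of a field on R * R are derivatives of its slices; this
is what turns vanishing partial derivatives into constancy. *)
Lemma is_derive_slice1 {W : normedModType R} (F : R * R -> W) (p : R * R) dF :
  is_derive p ((1, 0) : R * R) F dF -> is_derive p.1 (1 : R) (fun x => F (x, p.2)) dF.
Proof.
have E (h : R) : h *: ((1, 0) : R * R) + p = (h *: 1 + p.1, p.2).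
  by rewrite -[LHS]/(h * 1 + p.1, h * 0 + p.2) mulr0 add0r.
case: p E => a b E [H1 H2].
have E' : (fun h : R => h^-1 *: ((F \o shift (a, b)) (h *: ((1, 0) : R * R)) - F (a, b)))
   = (fun h : R => h^-1 *: (((fun x => F (x, b)) \o shift a) (h *: 1) - F (a, b))).
  by apply/funext => h /=; rewrite E.
by apply: DeriveDef => /=; [move: H1|move: H2]; rewrite /derivable /derive E'.
Qed.

Lemma is_derive_slice2 {W : normedModType R} (F : R * R -> W) (p : R * R) dF :
  is_derive p ((0, 1) : R * R) F dF -> is_derive p.2 (1 : R) (fun x => F (p.1, x)) dF.
Proof.
have E (h : R) : h *: ((0, 1) : R * R) + p = (p.1, h *: 1 + p.2).
  by rewrite -[LHS]/(h * 0 + p.1, h * 1 + p.2) mulr0 add0r.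
case: p E => a b E [H1 H2].
have E' : (fun h : R => h^-1 *: ((F \o shift (a, b)) (h *: ((0, 1) : R * R)) - F (a, b)))
   = (fun h : R => h^-1 *: (((fun x => F (a, x)) \o shift b) (h *: 1) - F (a, b))).
  by apply/funext => h /=; rewrite E.
by apply: DeriveDef => /=; [move: H1|move: H2]; rewrite /derivable /derive E'.
Qed.

Lemma rectangle_cst I J (F : R * R -> R) : is_interval I -> is_interval J ->
  (forall p, (I `*` J) p -> is_derive p ((1, 0) : R * R) F 0) ->
  (forall p, (I `*` J) p -> is_derive p ((0, 1) : R * R) F 0) ->
  forall p q, (I `*` J) p -> (I `*` J) q -> F p = F q.
Proof.
move=> itvI itvJ d1 d2 [a b] [a' b'] [/= Ia Jb] [/= Ia' Jb'].
transitivity (F (a', b)).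
  apply: (@zero_derive_interval_cst I (fun x => F (x, b))) => // x Ix.
  exact: (@is_derive_slice1 _ F (x, b) 0 (d1 (x, b) (conj Ix Jb))).
apply: (@zero_derive_interval_cst J (fun y => F (a', y))) => // y Jy.
exact: (@is_derive_slice2 _ F (a', y) 0 (d2 (a', y) (conj Ia' Jy))).
Qed.

End Calculus.

(** * The Minkowski product *)

Section MinkowskiProduct.
Context {R : realType}.
Implicit Types (x y w : 'rV[R]_4) (k : R).

Lemma minkC x y : mink x y = mink y x.
Proof. by apply: eq_bigr => i _; rewrite (mulrC (x 0 i)). Qed.

Lemma minkDl x y w : mink (x + y) w = mink x w + mink y w.
Proof. by rewrite /mink -big_split; apply: eq_bigr => i _ /=; rewrite mxE; ring. Qed.

Lemma minkZl k x y : mink (k *: x) y = k * mink x y.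
Proof. by rewrite /mink mulr_sumr; apply: eq_bigr => i _; rewrite mxE; ring. Qed.

Lemma minkNl x y : mink (- x) y = - mink x y.
Proof. by rewrite -scaleN1r minkZl mulN1r. Qed.

Lemma minkDr x y w : mink w (x + y) = mink w x + mink w y.
Proof. by rewrite minkC minkDl !(minkC w). Qed.

Lemma minkZr k x y : mink y (k *: x) = k * mink y x.
Proof. by rewrite minkC minkZl (minkC y). Qed.

Lemma minkNr x y : mink y (- x) = - mink y x.
Proof. by rewrite minkC minkNl (minkC y). Qed.

Definition minkE := (minkDl, minkDr, minkNl, minkNr, minkZl, minkZr).

Lemma mink0l y : mink 0 y = 0.
Proof. by rewrite -(scale0r 0) minkZl mul0r. Qed.

Lemma is_derive_mink {V : normedModType R} (F G : V -> 'rV[R]_4) (p v : V) dF dG :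
  is_derive p v F dF -> is_derive p v G dG ->
  is_derive p v (fun q => mink (F q) (G q)) (mink dF (G p) + mink (F p) dG).
Proof.
move=> /is_derive_mxP dF' /is_derive_mxP dG'.
have -> : (fun q => mink (F q) (G q)) = \sum_(i < 4) ((-1) ^+ (i == 3%N :> nat)
    *: ((fun q => F q 0 i) * (fun q => G q 0 i))).
  by apply/funext => q; rewrite fct_sumE.
apply: (@is_derive_eq _ _ _ _ _ _ _ _ (is_derive_sum _)).
  rewrite /mink -big_split; apply: eq_bigr => i _ /=.
  by rewrite -[LHS]/(_ * (_ * _ + _ * _)); ring.
Qed.

(** The Gram matrix of the frame is a diagonal matrix of signs, so, up to signs,
the matrix of the frame is inverted by the matrix of products with the frame.
Since left inverses are right inverses, every vector has the stated coordinates. *)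
Lemma frame_expansion (eps : R) a b c d x : eps * eps = 1 ->
  mink a a = 1 -> mink b b = 1 -> mink c c = eps -> mink d d = - eps ->
  mink a b = 0 -> mink a c = 0 -> mink a d = 0 ->
  mink b c = 0 -> mink b d = 0 -> mink c d = 0 ->
  x = mink x a *: a + mink x b *: b + (eps * mink x c) *: c
      - (eps * mink x d) *: d.
Proof.
move=> ee aa bb cc dd ab ac ad bc bd cd.
(* Default values of nth are never reached: both lists have length 4. *)
pose r (i : 'I_4) : 'rV[R]_4 := nth 0 [:: a; b; c; d] i.
pose s (i : 'I_4) : R := nth 0 [:: 1; 1; eps; - eps] i.
have ss i : s i * s i = 1.
  by case: i => -[|[|[|[|//]]]] ? /=; rewrite ?mulr1 ?mulrNN.
have gram i j : mink (r i) (r j) = s i * (i == j)%:R.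
  by case: i j => -[|[|[|[|//]]]] ? [[|[|[|[|//]]]] ?];
    rewrite /r /s -val_eqE /= ?mulr1 ?mulr0 // minkC.
pose C : 'M[R]_4 := \matrix_(k, j) ((-1) ^+ (k == 3%N :> nat) * r j 0 k * s j).
have coordC y j : (y *m C) 0 j = mink y (r j) * s j.
  by rewrite mxE /mink mulr_suml; apply: eq_bigr => k _; rewrite mxE; ring.
have BC : (\matrix_i r i) *m C = 1%:M.
  apply/matrixP => i j; transitivity ((row i (\matrix_i r i) *m C) 0 j).
    by rewrite -row_mul [RHS]mxE.
  rewrite rowK coordC gram mxE; have [->|_] := eqVneq i j.
    by rewrite mulr1 ss.
  by rewrite mulr0 mul0r.
transitivity (\sum_j (mink x (r j) * s j) *: r j).
  rewrite -[LHS]mulmx1 -(mulmx1C BC) mulmxA mulmx_sum_row.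
  by apply: eq_bigr => j _; rewrite coordC rowK.
rewrite !big_ord_recl big_ord0 /r /s /= !mulr1 addr0 mulrN scaleNr !addrA.
by rewrite !(mulrC eps).
Qed.

Lemma mink_in_span3 (i j k : nat) x y : in_span3 i j k x ->
  mink (e_ i) y = 0 -> mink (e_ j) y = 0 -> mink (e_ k) y = 0 -> mink x y = 0.
Proof.
pose C : 'M[R]_(4, 1) := \matrix_(m, _) ((-1) ^+ (m == 3%N :> nat) * y 0 m).
have minkC1 w : mink w y = (w *m C) 0 0.
  by rewrite mxE; apply: eq_bigr => m _; rewrite mxE; ring.
have minkC0 w : mink w y = 0 -> w *m C = 0.
  by rewrite minkC1 => w0; apply/matrixP => a b; rewrite !ord1 w0 mxE.
move=> xs /minkC0 i0 /minkC0 j0 /minkC0 k0; rewrite minkC1.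
suff : (x *m C <= (0 : 'M[R]_(1,1)))%MS by rewrite submx0 => /eqP ->; rewrite mxE.
apply: submx_trans (submxMr C xs) _.
by rewrite !(addsmxMr, addsmx_sub) i0 j0 k0 !sub0mx.
Qed.

Lemma mink_e i j : (0 < i <= 4)%N -> (0 < j <= 4)%N ->
  mink (e_ i) (e_ j) = ((-1) ^+ (i == 4) * (i == j)%:R : R).
Proof.
move=> i4 j4; rewrite /mink !big_ord_recl big_ord0 !mxE /=.
by move: i j i4 j4 => [|[|[|[|[|i]]]]] // [|[|[|[|[|j]]]]] //= _ _; ring.
Qed.

End MinkowskiProduct.

(** * Smoothness of sums of separated products *)

Section SeparatedFields.
Context {R : realType}.
Implicit Types (I J : set R) (p w : R * R).

Lemma smooth_cst {V W : normedModType R} (A : set V) (c : W) :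
  smooth_on A (fun=> c).
Proof.
move=> vs x _; suff [k ->] : exists k, iter_derive vs (fun=> c) = cst k.
  exact: differentiable_cst.
elim: vs => [|v vs [k /= ->]]; first by exists c.
by exists 0; apply/funext => y; rewrite derive_cst.
Qed.

Lemma near_eq_differentiable {V W : normedModType R} (F G : V -> W) x :
  (\near x, F x = G x) -> differentiable G x -> differentiable F x.
Proof.
move=> FG dG; have Fx := nbhs_singleton FG.
have expF : F \o shift x = cst (F x) + 'd G x +o_ 0 id.
  apply/eqaddoP => _/posnumP[e].
  have /eqaddoP/(_ _ (gt0 e)) := diff_locally dG.
  have : \forall y \near 0, F (y + x) = G (y + x) 
    by rewrite (near_shift x); apply: filterS FG => y /=; rewrite sub0r subrK.
  apply: filterS2 => y FGy.
  rewrite -[(G \o _ - _) y]/(G (y + x) - (G x + 'd G x y)).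
  by rewrite -[(F \o _ - _) y]/(F (y + x) - (F x + 'd G x y)) FGy Fx.
have cG := diff_continuous dG.
have dFG := diff_unique cG expF.
by apply/diff_locallyP; rewrite dFG.
Qed.

(** Iterated derivatives are taken of globally defined functions whereas
derivatives are known only on A; as A is open, knowing them on A is enough. *)
Lemma smooth_of_closed_class {V W : normedModType R} (A : set V)
    (C : (V -> W) -> Prop) : open A ->
  (forall F x, C F -> A x -> differentiable F x) ->
  (forall F v, C F -> exists2 G, C G & forall x, A x -> 'D_v F x = G x) ->
  forall F, C F -> smooth_on A F.
Proof.
move=> oA dC DC F CF vs x Ax.
have near_A (G1 G2 : V -> W) y : {in A, G1 =1 G2} -> A y -> \near y, G1 y = G2 y.
  by move=> G12 Ay; apply: filterS (open_nbhs_nbhs (conj oA Ay)) => z /mem_set/G12.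
suff [G CG FG] : exists2 G, C G & {in A, iter_derive vs F =1 G}.
  have dG := dC _ _ CG Ax.
  by apply: near_eq_differentiable dG; exact: near_A.
elim: vs => [|v vs [G CG FG] /=]; first by exists F.
have [G' CG' GG'] := DC G v CG; exists G' => // y /set_mem Ay.
by rewrite -GG' //; apply/near_eq_derive/near_A.
Qed.

Lemma differentiable_fst {V W : normedModType R} (p : V * W) :
  differentiable (fst : V * W -> V) p.
Proof.
have fstL : linear (fst : V * W -> V) by [].
pose fstLM := GRing.isLinear.Build _ _ _ _ _ fstL.
pose f : {linear _ -> _} := HB.pack (fst : V * W -> V) fstLM.
by apply: (@linear_differentiable _ _ _ f) => q; exact: cvg_fst.
Qed.

Lemma differentiable_snd {V W : normedModType R} (p : V * W) :
  differentiable (snd : V * W -> W) p.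
Proof.
have sndL : linear (snd : V * W -> W) by [].
pose sndLM := GRing.isLinear.Build _ _ _ _ _ sndL.
pose f : {linear _ -> _} := HB.pack (snd : V * W -> W) sndLM.
by apply: (@linear_differentiable _ _ _ f) => q; exact: cvg_snd.
Qed.

Lemma open_rectangle I J : open I -> open J -> open (I `*` J).
Proof.
move=> oI oJ; rewrite openE => p [Ip Jp]; exists (I, J) => //.
by split; apply: open_nbhs_nbhs.
Qed.

(** The scaled case is kept apart because a scalar multiple of phi would have to
be shown smooth again at each derivation. *)
Inductive separated {n : nat} I J : (R * R -> 'rV[R]_n) -> Prop :=
| SeparatedProduct (phi : R -> R) (psi : R -> 'rV[R]_n) of
    smooth_on I phi & smooth_on J psi :
    separated I J (fun q => phi q.1 *: psi q.2)
| SeparatedSum F G of separated I J F & separated I J G :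
    separated I J (fun q => F q + G q)
| SeparatedScale k F of separated I J F :
    separated I J (fun q => k *: F q).

Lemma differentiable_separated_product n (phi : R -> R) (psi : R -> 'rV[R]_n) p :
  differentiable phi p.1 -> differentiable psi p.2 ->
  differentiable (fun q => phi q.1 *: psi q.2) p.
Proof.
move=> dphi dpsi.
have -> : (fun q => phi q.1 *: psi q.2) = \sum_(j < n)
    (fun q : R * R => (phi q.1 * psi q.2 0 j) *: (delta_mx 0 j : 'rV[R]_n)).
  apply/funext => q; rewrite fct_sumE [psi _]row_sum_delta scaler_sumr.
  apply: eq_bigr => j _.
  by rewrite summxE (bigD1 j) //= big1 ?addr0 => [|i ij];
    rewrite !mxE ?eqxx ?mulr1 ?scalerA // [j == i]eq_sym (negPf ij) mulr0.
apply: differentiable_sum => j; apply: differentiableZl.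
apply: differentiableM; first exact: differentiable_comp (differentiable_fst p) _.
apply: (@differentiable_comp _ _ _ _ (fun q : R * R => psi q.2)
  (fun y : 'rV[R]_n => y 0 j)); last exact: differentiable_coord.
exact: differentiable_comp (differentiable_snd p) _.
Qed.

Lemma is_derive_separated_product n (phi : R -> R) (psi : R -> 'rV[R]_n) p w :
  differentiable phi p.1 -> differentiable psi p.2 ->
  is_derive p w (fun q => phi q.1 *: psi q.2)
    ((w.1 * derive1 phi p.1) *: psi p.2 + (w.2 * phi p.1) *: derive1 psi p.2).
Proof.
move=> dphi dpsi; apply/is_derive_mxP => i j; rewrite ord1.
have d1 := is_derive_fst phi p w dphi.
have /is_derive_mxP/(_ 0 j) d2 := is_derive_snd psi p w dpsi.
have -> : (fun q : R * R => (phi q.1 *: psi q.2) 0 j) =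
    (fun q => phi q.1) * (fun q => psi q.2 0 j).
  by apply/funext => q; rewrite mxE.
apply: is_derive_eq; rewrite !mxE /=.
by rewrite -[LHS]/(_ * (_ * _) + _ * (_ * _)); ring.
Qed.

Lemma separated_differentiable n I J (F : R * R -> 'rV[R]_n) p :
  separated I J F -> (I `*` J) p -> differentiable F p.
Proof.
move=> sF [Ip Jp]; elim: sF => {F} [phi psi sphi spsi|F G _ dF _ dG|k F _ dF].
- apply: differentiable_separated_product.
    exact: smooth_differentiable sphi Ip.
  exact: smooth_differentiable spsi Jp.
- exact: differentiableD.
- exact: differentiableZ.
Qed.

Lemma separated_derive n I J (F : R * R -> 'rV[R]_n) w : separated I J F ->
  exists2 G, separated I J G & forall p, (I `*` J) p -> 'D_w F p = G p.
Proof.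
elim=> {F} [phi psi sphi spsi|F G sF [F' sF' dF] sG [G' sG' dG]|k F sF [F' sF' dF]].
- exists (fun q => w.1 *: (derive1 phi q.1 *: psi q.2)
                  + w.2 *: (phi q.1 *: derive1 psi q.2)).
    by apply: SeparatedSum; apply: SeparatedScale; apply: SeparatedProduct => //;
      exact: smooth_derive1.
  move=> p [Ip Jp]; rewrite !scalerA.
  have := @is_derive_separated_product _ phi psi p w.
  by case=> //; [exact: smooth_differentiable sphi Ip
                |exact: smooth_differentiable spsi Jp].
- exists (fun q => F' q + G' q); first exact: SeparatedSum.
  move=> p Ap; rewrite -dF // -dG //; apply: deriveD;
    apply: diff_derivable; exact: (separated_differentiable _ I J).
- exists (fun q => k *: F' q); first exact: SeparatedScale.
  move=> p Ap; rewrite -dF //; apply: deriveZ.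
  apply: diff_derivable; exact: (separated_differentiable _ I J).
Qed.

Lemma separated_smooth n I J (F : R * R -> 'rV[R]_n) : open I -> open J ->
  separated I J F -> smooth_on (I `*` J) F.
Proof.
move=> oI oJ; apply: smooth_of_closed_class; first exact: open_rectangle.
  by move=> G p; exact: separated_differentiable.
by move=> G w; exact: separated_derive.
Qed.

End SeparatedFields.

(** * Meridian curves *)

Section UnitProfiles.
Set Implicit Arguments.
Unset Strict Implicit.
Context {R : realType}.

Record unit_profile (eps : R) (I : set R) (f g : R -> R) : Prop := UnitProfile {
  up_eps : eps * eps = 1;
  up_I : open_interval I;
  up_f : smooth_on I f;
  up_g : smooth_on I g;
  up_f_gt0 : forall u, I u -> 0 < f u;
  up_unit : forall u, I u -> derive1 f u ^+ 2 - eps * derive1 g u ^+ 2 = 1 }.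

Lemma double_eq0 (a : R) : a + a = 0 -> a = 0.
Proof. by move=> ?; lra. Qed.

Context (eps : R) (I : set R) (f g : R -> R).
Hypothesis up : unit_profile eps I f g.

Local Notation f1 := (derive1 f).
Local Notation g1 := (derive1 g).
Local Notation f2 := (derive1 f1).
Local Notation g2 := (derive1 g1).
Local Notation km := (meridian_curvature f g).
Local Notation A u := (g1 u + f u * km u).

Let ee : eps * eps = 1 := up_eps up.
Let oI : open I. Proof. by case: (up_I up). Qed.
Let itvI : is_interval I. Proof. by case: (up_I up). Qed.
Let I0 : I !=set0. Proof. by case: (up_I up). Qed.
Let sf : smooth_on I f := up_f up.
Let sg : smooth_on I g := up_g up.
Let sf1 : smooth_on I f1 := smooth_derive1 _ _ sf.
Let sg1 : smooth_on I g1 := smooth_derive1 _ _ sg.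
Let f_neq0 u : I u -> f u != 0.
Proof. by move/(up_f_gt0 up)/lt0r_neq0. Qed.

Let df u : I u -> is_derive u (1 : R) f (f1 u).
Proof. exact: smooth_is_derive. Qed.
Let dg u : I u -> is_derive u (1 : R) g (g1 u).
Proof. exact: smooth_is_derive. Qed.
Let df1 u : I u -> is_derive u (1 : R) f1 (f2 u).
Proof. exact: smooth_is_derive. Qed.
Let dg1 u : I u -> is_derive u (1 : R) g1 (g2 u).
Proof. exact: smooth_is_derive. Qed.

Lemma meridian_unit_derive u : I u -> f1 u * f2 u = eps * (g1 u * g2 u).
Proof.
move=> Iu; have d1 := df1 Iu; have d2 := dg1 Iu.
have dh : is_derive u 1 (f1 * f1 - eps *: (g1 * g1))
    (f1 u * f2 u + f1 u * f2 u - eps * (g1 u * g2 u + g1 u * g2 u)).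
  exact: is_derive_eq.
have : (f1 u * f2 u + f1 u * f2 u - eps * (g1 u * g2 u + g1 u * g2 u)) = 0.
  have unit y : I y -> (f1 * f1 - eps *: (g1 * g1)) y = 1.
    by move=> Iy; rewrite -(up_unit up Iy) !expr2.
  exact: (is_derive_cst_on _ _ _ _ _ _ oI Iu unit dh).
by rewrite mulrDr opprD addrACA => /double_eq0/subr0_eq.
Qed.

(** The acceleration of a curve of constant unit speed in the (pseudo-)Euclidean
plane is its curvature times the unit normal (eps g', f'). *)
Lemma meridian_f2 u : I u -> f2 u = eps * g1 u * km u.
Proof.
move=> Iu; have := meridian_unit_derive Iu.
have := up_unit up Iu; rewrite /meridian_curvature.
move: ee; generalize (f1 u) (g1 u) (f2 u) (g2 u) => a b a' b' ? U V.
transitivity (a * (a * a') - eps * b ^+ 2 * a'); last by rewrite V; ring.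
by rewrite -[LHS]mul1r -U; ring.
Qed.

Lemma meridian_g2 u : I u -> g2 u = f1 u * km u.
Proof.
move=> Iu; have := meridian_unit_derive Iu.
have := up_unit up Iu; rewrite /meridian_curvature.
move: ee; generalize (f1 u) (g1 u) (f2 u) (g2 u) => a b a' b' ? U V.
transitivity (a ^+2 * b' - b * (a * a')); last by ring.
by rewrite -[LHS]mul1r -U V; ring.
Qed.

Hypothesis km_neq0 : forall u, I u -> km u != 0.
Hypothesis g1_ge0 : forall u, I u -> 0 <= g1 u.

(** A zero of g' would be a minimum of g', whence f' km = g'' = 0 and f' = 0
there, against f'^2 - eps g'^2 = 1. *)
Lemma profile_g1_gt0 u : I u -> 0 < g1 u.
Proof.
move=> Iu; rewrite lt_neqAle g1_ge0 // andbT eq_sym; apply/negP => /eqP g1u.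
have /nbhs_ballP[r /= r0 rI] := open_nbhs_nbhs (conj oI Iu).
have inI x : x \in `]u - r, u + r[%R -> I x.
  rewrite in_itv /= => /andP[x1 x2]; apply: rI.
  by rewrite /ball /= distrC ltr_distl x1 x2.
have g2u : g2 u = 0.
  apply: is_derive_derive1; apply: (@derive1_at_min _ _ (u - r) (u + r)).
  - by rewrite lerD2l (le_trans _ (ltW r0)) // oppr_le0 ltW.
  - by move=> x /inI Ix; case: (dg1 Ix).
  - by rewrite in_itv /= ltrBlDr !ltrDl r0.
  - by move=> x /inI; rewrite g1u; exact: g1_ge0.
have /eqP := meridian_g2 Iu; rewrite g2u eq_sym mulf_eq0 (negPf (km_neq0 Iu)) orbF.
move=> /eqP f1u; have /eqP := up_unit up Iu.
by rewrite f1u g1u expr0n mulr0 subr0 eq_sym oner_eq0.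
Qed.

Lemma profile_f1_sqr u : I u -> f u * f1 u * (f u * f1 u) =
  f u ^+ 2 + eps * (f u * g1 u) ^+ 2.
Proof.
move=> Iu; have := up_unit up Iu; move: (f u) (f1 u) (g1 u) => a b c U.
by rewrite -[a ^+ 2]mulr1 -U; ring.
Qed.

Lemma is_derive_quadratic c u :
  is_derive u (1 : R) (id * id + (2 * c) *: id : R -> R) (2 * (u + c)).
Proof.
have d1 := is_derive_id u (1 : R).
apply: (is_derive_eq (is_deriveD (is_deriveM d1 d1) (is_deriveZ (2 * c) d1))).
by rewrite /GRing.scale /=; ring.
Qed.

Lemma is_derive_ff u : I u -> is_derive u (1 : R) (f * f) (2 * (f u * f1 u)).
Proof.
move=> Iu; apply: (is_derive_eq (is_deriveM (df Iu) (df Iu))).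
by rewrite /GRing.scale /=; move: (f u) (f1 u) => a b; ring.
Qed.

Lemma profile_quadratic_slope c d u :
  (forall x, I x -> f x ^+ 2 = x ^+ 2 + 2 * c * x + d) -> I u -> f u * f1 u = u + c.
Proof.
move=> fq Iu; have d1 := df Iu.
have dq := is_deriveB (is_derive_ff Iu) (is_derive_quadratic c u).
have cq x : I x -> (f * f - (id * id + (2 * c) *: id)) x = d.
  move=> Ix; rewrite -[LHS]/(f x * f x - (x * x + 2 * c * x)) -!expr2 fq //.
  by ring.
have := is_derive_cst_on _ _ _ _ _ _ oI Iu cq dq.
by move: (f u * f1 u) => y; lra.
Qed.

Lemma is_derive_ff1 u : I u ->
  is_derive u (1 : R) (f * f1) (1 + eps * g1 u * A u).
Proof.
move=> Iu; apply: (is_derive_eq (is_deriveM (df Iu) (df1 Iu))).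
rewrite (meridian_f2 Iu) -(up_unit up Iu).
rewrite /GRing.scale /=; move: (f u) (f1 u) (g1 u) (km u) => a b c k; ring.
Qed.

Lemma is_derive_fg1 u : I u -> is_derive u (1 : R) (f * g1) (f1 u * A u).
Proof.
move=> Iu; apply: (is_derive_eq (is_deriveM (df Iu) (dg1 Iu))).
rewrite (meridian_g2 Iu).
rewrite /GRing.scale /=; move: (f u) (f1 u) (g1 u) (km u) => a b c k; ring.
Qed.

Lemma profile_quadratic_slope_g c d u :
  (forall x, I x -> f x ^+ 2 = x ^+ 2 + 2 * c * x + d) -> I u ->
  (f u * g1 u) ^+ 2 = eps * (c ^+ 2 - d).
Proof.
move=> fq Iu; have := profile_f1_sqr Iu.
rewrite (profile_quadratic_slope fq Iu) (fq _ Iu); move: (f u * g1 u) => y H.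
rewrite -[LHS]mul1r -ee -mulrA; congr (_ * _).
have -> : eps * y ^+ 2 = (u + c) * (u + c) - (u ^+ 2 + 2 * c * u + d).
  by rewrite H; ring.
ring.
Qed.

(** Both implications integrate or differentiate (f f')' = 1 + eps g' A; the
constant eps (c^2 - d) is the value of (f g')^2, hence positive. *)
Lemma profile_quadraticP : (forall u, I u -> A u = 0) <->
  exists c d, 0 < eps * (c ^+ 2 - d) /\
    forall u, I u -> f u ^+ 2 = u ^+ 2 + 2 * c * u + d.
Proof.
split=> [A0|[c [d [_ fq]]] u Iu].
  have dff1 u : I u -> is_derive u (1 : R) (f * f1) 1.
    by move=> Iu; have := is_derive_ff1 Iu; rewrite A0 // mulr0 addr0.
  have [c ff1] := eq_is_derive_cst I (f * f1) id (fun=> 1) itvI dff1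
    (fun u _ => is_derive_id u 1) I0.
  have dff u : I u -> is_derive u (1 : R) (f * f) (2 * (u + c)).
    by move=> Iu; rewrite -(ff1 u Iu); exact: is_derive_ff.
  have [d ff] := eq_is_derive_cst I (f * f) (id * id + (2 * c) *: id)
      (fun u => 2 * (u + c)) itvI dff (fun u _ => is_derive_quadratic c u) I0.
  have fq u : I u -> f u ^+ 2 = u ^+ 2 + 2 * c * u + d.
    by move=> /ff; rewrite -[LHS]/(f u * f u) -!expr2 => ->; rewrite expr2.
  exists c, d; split=> //; have [u0 Iu0] := I0.
  rewrite -(profile_quadratic_slope_g fq Iu0) exprn_gt0 // mulr_gt0 //.
    exact: up_f_gt0 up _ Iu0.
  exact: profile_g1_gt0.
have cff1 x : I x -> (f * f1 - id) x = c.
  move=> Ix; rewrite -[LHS]/(f x * f1 x - x) (profile_quadratic_slope fq Ix).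
  by rewrite addrC addKr.
have dff1 : is_derive u (1 : R) (f * f1 - id) (1 + eps * g1 u * A u - 1).
  by apply: is_deriveB; exact: is_derive_ff1.
have := is_derive_cst_on _ _ _ _ _ _ oI Iu cff1 dff1.
have := lt0r_neq0 (profile_g1_gt0 Iu).
rewrite addrC addKr -mulrA => g0 /(congr1 ( *%R eps)).
by rewrite mulrA ee mul1r mulr0 => /eqP; rewrite mulf_eq0 (negPf g0) => /eqP.
Qed.

(** By the sign convention g' is the quotient of Num.sqrt (eps (c^2 - d)) by f,
and 1 / f is the derivative of ln |u + c + f|.  The argument u + c + f does not
vanish since (u + c)^2 - f^2 = c^2 - d is nonzero. *)
Lemma profile_logarithm c d : 0 < eps * (c ^+ 2 - d) ->
  (forall u, I u -> f u ^+ 2 = u ^+ 2 + 2 * c * u + d) ->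
  exists a, forall u, I u ->
    g u = Num.sqrt (eps * (c ^+ 2 - d)) * ln `|u + c + f u| + a.
Proof.
move=> q0 fq; pose k := Num.sqrt (eps * (c ^+ 2 - d)).
have g1E u : I u -> g1 u = k / f u.
  move=> Iu; rewrite /k -(profile_quadratic_slope_g fq Iu) sqrtr_sqr ger0_norm.
    by rewrite mulrC mulKf ?f_neq0.
  by rewrite mulr_ge0 ?g1_ge0 // ltW // (up_f_gt0 up).
pose W := id + cst c + f.
have dW u : I u -> is_derive u (1 : R) W (1 + 0 + f1 u).
  by move=> Iu; exact: is_deriveD (df Iu).
have W0 u : I u -> W u != 0.
  move=> Iu; rewrite -[W u]/(u + c + f u); apply/negP => /eqP W0.
  have : (u + c) ^+ 2 = f u ^+ 2 by rewrite -sqrrN; congr (_ ^+ 2); lra.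
  rewrite (fq _ Iu) => H; have cd : c ^+ 2 - d = 0 by lra.
  by move: q0; rewrite cd mulr0 ltxx.
have [s Ws] := interval_sign_cst I W itvI
  (fun u Iu => @ex_derive _ _ _ _ _ _ _ (dW u Iu)) W0 I0.
pose V x := (-1) ^+ s * W x.
have VE u : I u -> V u = `|W u|.
  by move=> Iu; rewrite /V {1}(Ws u Iu) mulrA -expr2 sqrr_sign mul1r.
have dlnW u : I u -> is_derive u (1 : R) (fun x => ln `|W x|) (f u)^-1.
  move=> Iu; apply: (@near_eq_is_derive R R R (@ln R \o V) (fun x => ln `|W x|) u 1).
    by apply: filterS (open_nbhs_nbhs (conj oI Iu)) => x Ix /=; rewrite VE.
  have dln : is_derive (V u) (1 : R) (@ln R) (V u)^-1.
    by apply: is_derive1_ln; rewrite VE // normr_gt0 W0.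
  have dV : is_derive u (1 : R) V ((-1) ^+ s * (1 + 0 + f1 u)).
    exact: (is_deriveZ ((-1) ^+ s) (dW u Iu)).
  apply: (is_derive_eq (is_derive1_comp dln dV)); rewrite /V.
  have ff1 := profile_quadratic_slope fq Iu.
  have Wf : f u * (1 + 0 + f1 u) = W u.
    by rewrite addr0 mulrDr mulr1 ff1 addrC.
  rewrite -Wf; have := W0 _ Iu; rewrite -Wf mulf_eq0 negb_or.
  move=> /andP[f0 w0]; have s0 : (-1) ^+ s != 0 :> R by rewrite signr_eq0.
  move: (f u) f0 (1 + 0 + f1 u) w0 ((-1) ^+ s) s0 => x x0 y y0 w w0.
  by field; rewrite x0 y0 w0.
have dg' u : I u -> is_derive u (1 : R) g (k / f u).
  by move=> Iu; rewrite -g1E //; exact: dg.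
have [a ga] := eq_is_derive_cst I g (k *: (fun x => ln `|W x|))
  (fun u => k / f u) itvI dg' (fun u Iu => is_deriveZ k (dlnW u Iu)) I0.
by exists a => u /ga ->.
Qed.

(** The constant of integration of (f g')' = m f' is eps c rather than c: this is
what makes the differential equation match the radicands in both signatures. *)
Lemma profile_affine m : (forall u, I u -> A u = m) -> exists c, forall u, I u ->
  (f u * f1 u) ^+ 2 = f u ^+ 2 + eps * (m * f u + eps * c) ^+ 2.
Proof.
move=> Am.
have dfg1 u : I u -> is_derive u (1 : R) (f * g1) (m * f1 u).
  by move=> Iu; have := is_derive_fg1 Iu; rewrite Am // [_ * m]mulrC.
have [C fg1] := eq_is_derive_cst I (f * g1) (m *: f) (fun u => m * f1 u) itvI dfg1
  (fun u Iu => is_deriveZ m (df Iu)) I0.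
exists (eps * C) => u Iu; rewrite expr2 profile_f1_sqr // mulrA ee mul1r.
by have := fg1 u Iu; rewrite -[LHS]/(f u * g1 u) => ->.
Qed.

(** The sign s is that of a f + eps c.  At points with f' = 0, which occur only
for eps = -1, A is found by differentiating (A - (-1)^s a) f' = 0 once more. *)
Lemma affine_profile a c : (forall u, I u ->
    (f u * f1 u) ^+ 2 = f u ^+ 2 + eps * (a * f u + eps * c) ^+ 2) ->
  exists s : bool, forall u, I u -> A u = (-1) ^+ s * a.
Proof.
move=> ode; pose h := a *: f + cst (eps * c).
have dh u : I u -> is_derive u (1 : R) h (a * f1 u + 0).
  by move=> Iu; exact: is_deriveD (is_deriveZ a (df Iu)) (is_derive_cst _ u 1).
have fg1_h u : I u -> f u * g1 u = `|h u|.
  move=> Iu; rewrite -[LHS]ger0_norm; last first.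
    by rewrite mulr_ge0 ?g1_ge0 // ltW // (up_f_gt0 up).
  apply/eqP; rewrite -(@eqrXn2 _ 2) // -!normrX; apply/eqP; congr `|_|.
  have := ode u Iu; rewrite [X in X = _]expr2 profile_f1_sqr // => /addrI.
  move=> H; rewrite -[LHS]mul1r -[RHS]mul1r -ee -!(mulrA eps eps).
  by congr (_ * _); exact: H.
have h0 u : I u -> h u != 0.
  by move=> Iu; rewrite -normr_eq0 -fg1_h // mulf_neq0 ?f_neq0 // lt0r_neq0 ?profile_g1_gt0.
have [s hs] := interval_sign_cst I h itvI
  (fun u Iu => @ex_derive _ _ _ _ _ _ _ (dh u Iu)) h0 I0.
exists s; pose B := g1 + f * (f1 * g2 - g1 * f2) - cst ((-1) ^+ s * a).
have Bf1 u : I u -> (B * f1) u = 0.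
  move=> Iu; have fgh x : I x -> (f * g1 - (-1) ^+ s *: h) x = 0.
    move=> Ix; rewrite -[LHS]/(f x * g1 x - (-1) ^+ s * h x) fg1_h // {2}(hs x Ix).
    by rewrite mulrA -expr2 sqrr_sign mul1r subrr.
  have := is_derive_cst_on _ _ _ _ _ _ oI Iu fgh
    (is_deriveB (is_derive_fg1 Iu) (is_deriveZ ((-1) ^+ s) (dh u Iu))).
  rewrite -[_ *: _]/(_ * _) addr0 => H.
  by rewrite -[LHS]/((A u - (-1) ^+ s * a) * f1 u) -H; ring.
move=> u Iu; apply/eqP; rewrite -subr_eq0 -[_ - _]/(B u); apply/eqP.
have [f1u|f1u] := eqVneq (f1 u) 0; last first.
  by have /eqP := Bf1 u Iu; rewrite mulf_eq0 (negPf f1u) orbF => /eqP.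
have d1 := df Iu; have d2 := df1 Iu; have d3 := dg1 Iu.
have d4 := smooth_is_derive _ _ _ (smooth_derive1 _ _ sf1) Iu.
have d5 := smooth_is_derive _ _ _ (smooth_derive1 _ _ sg1) Iu.
have dB := is_deriveB (is_deriveD d3 (is_deriveM d1
  (is_deriveB (is_deriveM d2 d5) (is_deriveM d3 d4))))
  (is_derive_cst ((-1) ^+ s * a : R) u 1).
have := is_derive_cst_on _ _ _ _ _ _ oI Iu Bf1 (is_deriveM dB d2).
rewrite f1u scale0r addr0 -[_ *: _]/(_ * _) (meridian_f2 Iu) => /eqP.
rewrite !mulf_eq0 (negPf (km_neq0 Iu)) (gt_eqF (profile_g1_gt0 Iu)) !orbF.
case/orP => [/eqP //|/eqP eps0].
by move: ee; rewrite eps0 mul0r => /esym/eqP; rewrite oner_eq0.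
Qed.

Lemma profile_logarithmicP : (forall u, I u -> A u = 0) <->
  exists (a c d : R) (s1 s2 : bool), 0 < eps * (c ^+ 2 - d) /\
  forall u, I u -> let r := Num.sqrt (u ^+ 2 + 2 * c * u + d) in
    [/\ 0 <= u ^+ 2 + 2 * c * u + d,
        f u = (-1) ^+ s1 * r &
        g u = (-1) ^+ s2 * Num.sqrt (eps * (c ^+ 2 - d)) * ln `|u + c + r| + a].
Proof.
apply: (iff_trans profile_quadraticP); split.
  move=> [c [d [q0 fq]]]; have [a ga] := profile_logarithm q0 fq.
  exists a, c, d, false, false; split=> // u Iu r.
  have rE : r = f u by rewrite /r -fq // sqrtr_sqr gtr0_norm // (up_f_gt0 up).
  by rewrite -fq // sqr_ge0 rE ga // !mul1r.
move=> [a [c [d [s1 [s2 [cd H]]]]]]; exists c, d; split=> // u /H[q0 -> _].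
by rewrite exprMn sqrr_sign mul1r sqr_sqrtr.
Qed.

Lemma profile_affineP : (exists m, m != 0 /\ forall u, I u -> A u = m) <->
  exists a c, a != 0 /\ forall u, I u ->
    (f u * f1 u) ^+ 2 = f u ^+ 2 + eps * (a * f u + eps * c) ^+ 2.
Proof.
split=> [[m [m0 /profile_affine[c ode]]]|[a [c [a0 /affine_profile[s As]]]]].
  by exists m, c.
by exists ((-1) ^+ s * a); split=> //; rewrite mulf_neq0 ?signr_eq0.
Qed.

End UnitProfiles.

(** * Geometry of a meridian surface *)

Section MeridianSurfaces.
Set Implicit Arguments.
Unset Strict Implicit.
Context {R : realType}.

(** The common form of the two types of surfaces: eps = 1 for the elliptic and
eps = -1 for the hyperbolic type, with e the axis of rotation. *)
Record meridian_data (eps : R) (e : 'rV[R]_4) (I J : set R) (f g : R -> R)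
    (l n : R -> 'rV[R]_4) : Prop := MeridianData {
  md_profile : unit_profile eps I f g;
  md_ee : mink e e = - eps;
  md_J : open_interval J;
  md_l : smooth_on J l;
  md_n : smooth_on J n;
  md_le : forall v, J v -> mink (l v) e = 0;
  md_ne : forall v, J v -> mink (n v) e = 0;
  md_frame : forall v, J v -> orthonormal3 eps (l v) (derive1 l v) (n v) }.

Definition meridian_surface (e : 'rV[R]_4) f g l (p : R * R) : 'rV[R]_4 :=
  f p.1 *: l p.2 + g p.1 *: e.

Lemma mink_cst_derive (J : set R) (F G : R -> 'rV[R]_4) c v : open J ->
  smooth_on J F -> smooth_on J G -> (forall v, J v -> mink (F v) (G v) = c) ->
  J v -> mink (derive1 F v) (G v) + mink (F v) (derive1 G v) = 0.
Proof.
move=> oJ sF sG FGc Jv.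
apply: (is_derive_cst_on _ (fun y => mink (F y) (G y)) c _ (1 : R) _ oJ Jv FGc).
by apply: is_derive_mink; exact: smooth_is_derive Jv.
Qed.

Context (eps : R) (e : 'rV[R]_4) (I J : set R) (f g : R -> R)
        (l n : R -> 'rV[R]_4).
Hypothesis md : meridian_data eps e I J f g l n.

Local Notation t := (derive1 l).
Local Notation f1 := (derive1 f).
Local Notation g1 := (derive1 g).
Local Notation f2 := (derive1 f1).
Local Notation g2 := (derive1 g1).
Local Notation km := (meridian_curvature f g).
Local Notation kappa := (spherical_curvature l n).
Local Notation z := (meridian_surface e f g l).

Let up := md_profile md.
Let ee : eps * eps = 1 := up_eps up.
Let oI : open I. Proof. by case: (up_I up). Qed.
Let oJ : open J. Proof. by case: (md_J md). Qed.
Let sf : smooth_on I f := up_f up.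
Let sg : smooth_on I g := up_g up.
Let sl : smooth_on J l := md_l md.
Let sn : smooth_on J n := md_n md.
Let f_neq0 u : I u -> f u != 0.
Proof. by move/(up_f_gt0 up)/lt0r_neq0. Qed.

Lemma spherical_te v : J v -> mink (t v) e = 0.
Proof.
move=> Jv; have := mink_cst_derive oJ sl (smooth_cst _ _) (md_le md) Jv.
by rewrite derive1_cst [X in _ + X]minkC mink0l addr0.
Qed.

Lemma spherical_expansion x v : J v ->
  x = mink x (l v) *: l v + mink x (t v) *: t v + (eps * mink x (n v)) *: n v
      - (eps * mink x e) *: e.
Proof.
move=> Jv; have [[ll tt nn] [lt ln tn]] := md_frame md Jv.
exact: (frame_expansion eps _ _ _ _ x ee ll tt nn (md_ee md) lt ln
  (md_le md Jv) tn (spherical_te Jv) (md_ne md Jv)).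
Qed.

Lemma spherical_frenet_t v : J v -> derive1 t v = - l v + (eps * kappa v) *: n v.
Proof.
move=> Jv; have [[ll tt nn] [lt ln tn]] := md_frame md Jv.
have st := smooth_derive1 _ _ sl.
have t'e : mink (derive1 t v) e = 0.
  have := mink_cst_derive oJ st (smooth_cst _ _) (spherical_te) Jv.
  by rewrite derive1_cst [X in _ + X]minkC mink0l addr0.
have t't : mink (derive1 t v) (t v) = 0.
  have c w : J w -> mink (t w) (t w) = 1.
    by move=> Jw; have [[]] := md_frame md Jw.
  have := mink_cst_derive oJ st st c Jv.
  by rewrite [X in _ + X]minkC => /double_eq0.
have t'l : mink (derive1 t v) (l v) = - 1.
  have c w : J w -> mink (t w) (l w) = 0.
    by move=> Jw; have [_ [? _ _]] := md_frame md Jw; rewrite minkC.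
  have := mink_cst_derive oJ st sl c Jv.
  by rewrite tt => /eqP; rewrite addr_eq0 => /eqP.
rewrite [LHS](spherical_expansion _ Jv) t't t'l t'e.
by rewrite mulr0 !scale0r subr0 addr0 scaleN1r.
Qed.

Lemma spherical_frenet_n v : J v -> derive1 n v = - kappa v *: t v.
Proof.
move=> Jv; have [[ll tt nn] [lt ln tn]] := md_frame md Jv.
have st := smooth_derive1 _ _ sl.
have n'e : mink (derive1 n v) e = 0.
  have := mink_cst_derive oJ sn (smooth_cst _ _) (md_ne md) Jv.
  by rewrite derive1_cst [X in _ + X]minkC mink0l addr0.
have n'n : mink (derive1 n v) (n v) = 0.
  have c w : J w -> mink (n w) (n w) = eps.
    by move=> Jw; have [[]] := md_frame md Jw.
  have := mink_cst_derive oJ sn sn c Jv.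
  by rewrite [X in _ + X]minkC => /double_eq0.
have n'l : mink (derive1 n v) (l v) = 0.
  have c w : J w -> mink (n w) (l w) = 0.
    by move=> Jw; have [_ [_ ? _]] := md_frame md Jw; rewrite minkC.
  have := mink_cst_derive oJ sn sl c Jv.
  by rewrite [mink (n v) _]minkC tn addr0.
have n't : mink (derive1 n v) (t v) = - kappa v.
  have c w : J w -> mink (n w) (t w) = 0.
    by move=> Jw; have [_ [_ _ ?]] := md_frame md Jw; rewrite minkC.
  have := mink_cst_derive oJ sn st c Jv.
  by rewrite [mink (n v) _]minkC => /eqP; rewrite addr_eq0 => /eqP.
rewrite [LHS](spherical_expansion _ Jv) n'n n'l n'e n't.
by rewrite mulr0 !scale0r subr0 addr0 add0r.
Qed.

(** The unit normal of the meridian inside the plane spanned by l and e. *)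
Definition axial_normal (p : R * R) : 'rV[R]_4 :=
  (eps * g1 p.1) *: l p.2 + f1 p.1 *: e.

Local Notation n2 := axial_normal.
Local Notation A u := (g1 u + f u * km u).

Lemma is_derive_axial (a b : R -> R) p w : smooth_on I a -> smooth_on I b ->
  (I `*` J) p -> is_derive p w (fun q => a q.1 *: l q.2 + b q.1 *: e)
    (w.1 *: (derive1 a p.1 *: l p.2 + derive1 b p.1 *: e)
     + (w.2 * a p.1) *: t p.2).
Proof.
move=> sa sb [Ip Jp]; have se := @smooth_cst R R _ J e.
have da := is_derive_separated_product _ a l p w
  (smooth_differentiable _ _ _ sa Ip) (smooth_differentiable _ _ _ sl Jp).
have db := is_derive_separated_product _ b (fun=> e) p w
  (smooth_differentiable _ _ _ sb Ip) (smooth_differentiable _ _ _ se Jp).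
apply: (is_derive_eq (is_deriveD da db)).
rewrite derive1_cst scaler0 addr0 scalerDr !scalerA.
by rewrite addrAC.
Qed.

Lemma derive_near_rect (F G : R * R -> 'rV[R]_4) p w : (I `*` J) p ->
  (forall q, (I `*` J) q -> F q = G q) -> 'D_w F p = 'D_w G p.
Proof.
move=> Ap FG; apply: near_eq_derive.
exact: filterS FG (open_nbhs_nbhs (conj (open_rectangle _ _ oI oJ) Ap)).
Qed.

Lemma z_uE p : (I `*` J) p -> z_u z p = f1 p.1 *: l p.2 + g1 p.1 *: e.
Proof.
move=> Ap; rewrite /z_u.
rewrite (@derive_val _ _ _ _ _ _ _ (is_derive_axial (1, 0) sf sg Ap)) /=.
by rewrite mul0r scale0r addr0 scale1r.
Qed.

Lemma z_vE p : (I `*` J) p -> z_v z p = f p.1 *: t p.2.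
Proof.
move=> Ap; rewrite /z_v.
rewrite (@derive_val _ _ _ _ _ _ _ (is_derive_axial (0, 1) sf sg Ap)) /=.
by rewrite mul1r scale0r add0r.
Qed.

Lemma z_uuE p w : (I `*` J) p -> 'D_w (fun q => 'D_((1, 0) : R * R) z q) p =
  w.1 *: (f2 p.1 *: l p.2 + g2 p.1 *: e) + (w.2 * f1 p.1) *: t p.2.
Proof.
move=> Ap; rewrite (derive_near_rect _ Ap z_uE).
exact: (@derive_val _ _ _ _ _ _ _
  (is_derive_axial w (smooth_derive1 _ _ sf) (smooth_derive1 _ _ sg) Ap)).
Qed.

Lemma z_vvE p : (I `*` J) p ->
  'D_((0, 1) : R * R) (fun q => 'D_((0, 1) : R * R) z q) p
  = f p.1 *: derive1 t p.2.
Proof.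
move=> Ap; rewrite (derive_near_rect _ Ap z_vE); case: Ap => Ip Jp.
rewrite (@derive_val _ _ _ _ _ _ _ (is_derive_separated_product _ f t p (0, 1)
  (smooth_differentiable _ _ _ sf Ip)
  (smooth_differentiable _ _ _ (smooth_derive1 _ _ sl) Jp))) /=.
by rewrite mul0r scale0r add0r mul1r.
Qed.

Lemma is_derive_axial_normal p w : (I `*` J) p -> is_derive p w n2
  ((w.1 * eps * km p.1) *: z_u z p + (w.2 * eps * g1 p.1) *: t p.2).
Proof.
move=> Ap; have [Ip Jp] := Ap; have se := @smooth_cst R R _ J e.
have sf1 := smooth_derive1 _ _ sf; have sg1 := smooth_derive1 _ _ sg.
have dg1 := is_derive_separated_product _ g1 l p w
  (smooth_differentiable _ _ _ sg1 Ip) (smooth_differentiable _ _ _ sl Jp).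
have df1 := is_derive_separated_product _ f1 (fun=> e) p w
  (smooth_differentiable _ _ _ sf1 Ip) (smooth_differentiable _ _ _ se Jp).
have -> : n2 = eps *: (fun q => g1 q.1 *: l q.2) + (fun q => f1 q.1 *: e).
  by apply/funext => q; rewrite /axial_normal -scalerA.
apply: (is_derive_eq (is_deriveD (is_deriveZ eps dg1) df1)).
rewrite derive1_cst scaler0 addr0 z_uE // (meridian_f2 up Ip) (meridian_g2 up Ip).
rewrite !scalerDr !scalerA addrAC; congr (_ *: _ + _ *: _ + _ *: _).
- ring.
- by rewrite -[LHS]mulr1; ring.
- ring.
Qed.

Lemma is_derive_spherical_normal p w : (I `*` J) p ->
  is_derive p w (fun q => n q.2) ((- w.2 * kappa p.2) *: t p.2).
Proof.
move=> [_ Jp].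
have := is_derive_snd n p w (smooth_differentiable _ _ _ sn Jp).
by rewrite spherical_frenet_n // scalerA mulrN mulNr.
Qed.

Lemma mink_z_u p : (I `*` J) p ->
  [/\ mink (z_u z p) (z_u z p) = 1, mink (z_u z p) (t p.2) = 0,
      mink (z_u z p) (n p.2) = 0 & mink (z_u z p) (n2 p) = 0].
Proof.
move=> Ap; have [Ip Jp] := Ap.
have [[ll tt nn] [lt ln tn]] := md_frame md Jp.
have le := md_le md Jp; have te := spherical_te Jp; have ne := md_ne md Jp.
have U := up_unit up Ip; rewrite z_uE // /axial_normal !minkE.
rewrite !(minkC e) ll lt ln le te ne (md_ee md).
split.
- by rewrite -[RHS]U; ring.
- by rewrite !mulr0 addr0.
- by rewrite !mulr0 addr0.
- ring.
Qed.

Lemma mink_axial_normal p : (I `*` J) p ->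
  [/\ mink (n2 p) (n2 p) = - eps, mink (t p.2) (n2 p) = 0 &
      mink (n p.2) (n2 p) = 0].
Proof.
move=> Ap; have [Ip Jp] := Ap.
have [[ll tt nn] [lt ln tn]] := md_frame md Jp.
have le := md_le md Jp; have te := spherical_te Jp; have ne := md_ne md Jp.
have U := up_unit up Ip; rewrite /axial_normal !minkE.
rewrite !(minkC e) !(minkC _ (l _)) ll lt ln le te ne (md_ee md).
split; last 2 first.
- by rewrite !mulr0 addr0.
- by rewrite !mulr0 addr0.
transitivity (- eps * (f1 p.1 ^+ 2 - eps * g1 p.1 ^+ 2)); first by ring.
by rewrite U mulr1.
Qed.

Lemma first_form p : (I `*` J) p ->
  [/\ EE z p = 1, FF z p = 0 & GG z p = f p.1 ^+ 2].
Proof.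
move=> Ap; have [Ip Jp] := Ap; have [uu ut _ _] := mink_z_u Ap.
have [[_ tt _] _] := md_frame md Jp.
by rewrite /EE /FF /GG z_vE // !minkE uu ut tt mulr0 mulr1 expr2; split.
Qed.

(** The shape of the tangential part for a first fundamental form with
coefficients 1, 0, k^2. *)
Lemma drop_tangent (x a b c d : 'rV[R]_4) (k xa xb : R) : k != 0 ->
  x = xa *: a + xb *: b + c - d ->
  x - (1 * k ^+ 2 - 0 ^+ 2)^-1 *: ((k ^+ 2 * xa - 0 * (k * xb)) *: a
    + (1 * (k * xb) - 0 * xa) *: (k *: b)) = c - d.
Proof.
move=> k0 ->; suff -> : (1 * k ^+ 2 - 0 ^+ 2)^-1 *: ((k ^+ 2 * xa - 0 * (k * xb)) *: a
    + (1 * (k * xb) - 0 * xa) *: (k *: b)) = xa *: a + xb *: b.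
  by move: (_ + xb *: b) => s; rewrite -(addrA s) (addrC s) addrK.
by rewrite scalerDr !scalerA; congr (_ *: _ + _ *: _); field.
Qed.

(** The frame z_u, t, n, n2 is orthonormal with signs 1, 1, eps, -eps, and its
first two vectors span the tangent plane. *)
Lemma normal_partE p x : (I `*` J) p -> normal_part z p x =
  (eps * mink x (n p.2)) *: n p.2 - (eps * mink x (n2 p)) *: n2 p.
Proof.
move=> Ap; have [Ip Jp] := Ap; have [uu ut un un2] := mink_z_u Ap.
have [n2n2 tn2 nn2] := mink_axial_normal Ap.
have [[_ tt nn] [_ _ tn]] := md_frame md Jp.
rewrite /normal_part /tangent_part; have [-> -> ->] := first_form Ap.
have x_exp := frame_expansion eps _ _ _ _ x ee uu tt nn n2n2 ut un un2 tn tn2 nn2.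
rewrite z_vE // minkZr; move: (f_neq0 Ip) x_exp; exact: drop_tangent.
Qed.

Lemma axial_mink_n a b v : J v -> mink (a *: l v + b *: e) (n v) = 0.
Proof.
move=> Jv; have [_ [_ ln _]] := md_frame md Jv.
by rewrite !minkE ln (minkC e) (md_ne md Jv) !mulr0 addr0.
Qed.

Lemma axial_mink_n2 a b p : J p.2 ->
  mink (a *: l p.2 + b *: e) (n2 p) = eps * (a * g1 p.1 - b * f1 p.1).
Proof.
move=> Jp; have [[ll _ _] _] := md_frame md Jp; rewrite /axial_normal.
move: (g1 p.1) (f1 p.1) => c d.
by rewrite !minkE ll (minkC e) (md_le md Jp) (md_ee md); ring.
Qed.

Lemma sff_uu p : (I `*` J) p -> sff z p (1, 0) (1, 0) = km p.1 *: n2 p.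
Proof.
move=> Ap; have [Ip Jp] := Ap; rewrite /sff normal_partE // z_uuE //=.
rewrite mul0r scale0r addr0 scale1r axial_mink_n // axial_mink_n2 //.
rewrite /meridian_curvature.
move: (f1 p.1) (g1 p.1) (f2 p.1) (g2 p.1) (n2 p) (n p.2) => a b a' b' x y.
rewrite mulr0 scale0r sub0r -scaleNr mulrA ee mul1r; congr (_ *: _); ring.
Qed.

Lemma sff_vv p : (I `*` J) p -> sff z p (0, 1) (0, 1) =
  (f p.1 * (eps * kappa p.2)) *: n p.2 + (f p.1 * g1 p.1) *: n2 p.
Proof.
move=> Ap; have [Ip Jp] := Ap; rewrite /sff normal_partE // z_vvE //=.
have [n2n2 tn2 nn2] := mink_axial_normal Ap.
have [[_ _ nn] [_ ln _]] := md_frame md Jp.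
have ln2 : mink (l p.2) (n2 p) = eps * g1 p.1.
  have := axial_mink_n2 1 0 Jp; rewrite scale1r scale0r addr0 => ->.
  by move: (g1 p.1) (f1 p.1) => a b; ring.
rewrite spherical_frenet_t // !minkZl !minkDl !minkNl !minkZl nn ln nn2 ln2.
move: (f p.1) (g1 p.1) (kappa p.2) (n2 p) (n p.2) => a b k x y.
rewrite -scaleNr; congr (_ *: _ + _ *: _).
  transitivity ((eps * eps) * (a * (eps * k))); first ring.
  by rewrite ee mul1r.
transitivity ((eps * eps) * (a * b)); first ring.
by rewrite ee mul1r.
Qed.

Lemma half_trace (r k k' h : R) (x y a b c : 'rV[R]_4) : r != 0 ->
  a = k' *: x -> b = (r * k) *: y + (r * h) *: x ->
  (2 * (1 * r ^+ 2 - 0 ^+ 2))^-1 *: (r ^+ 2 *: a - (2 * 0) *: c + 1 *: b)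
  = (2 * r)^-1 *: (k *: y + (h + r * k') *: x).
Proof.
move=> r0 -> ->; rewrite mulr0 scale0r subr0 scale1r !scalerDr !scalerA.
rewrite addrCA -scalerDl.
by congr (_ *: _ + _ *: _); field.
Qed.

Lemma mean_curvatureE p : (I `*` J) p -> mean_curvature z p =
  (2 * f p.1)^-1 *: ((eps * kappa p.2) *: n p.2 + A p.1 *: n2 p).
Proof.
move=> Ap; have [Ip Jp] := Ap; rewrite /mean_curvature.
have [-> -> ->] := first_form Ap.
exact: half_trace (f_neq0 Ip) (sff_uu Ap) (sff_vv Ap).
Qed.

Lemma is_derive_frame_combination a b p w : (I `*` J) p ->
  is_derive p w (fun q => a *: n q.2 + b *: n2 q)
    ((b * (w.1 * eps * km p.1)) *: z_u z p
     + (b * (w.2 * eps * g1 p.1) - a * (w.2 * kappa p.2)) *: t p.2).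
Proof.
move=> Ap; have dn := is_derive_spherical_normal w Ap.
have dn2 := is_derive_axial_normal w Ap.
apply: (is_derive_eq (is_deriveD (is_deriveZ a dn) (is_deriveZ b dn2))).
move: (z_u z p) (t p.2) (km p.1) (g1 p.1) (kappa p.2) => x y c d k.
rewrite scalerDr !scalerA addrCA -scalerDl.
by congr (_ *: _ + _ *: _); ring.
Qed.

Lemma parallel_frame_combination a b :
  parallel_section (I `*` J) z (fun q => a *: n q.2 + b *: n2 q).
Proof.
move=> w _ p Ap; have [Ip Jp] := Ap; rewrite /normal_connection normal_partE //.
have [_ _ un un2] := mink_z_u Ap; have [_ tn2 _] := mink_axial_normal Ap.
have [_ [_ _ tn]] := md_frame md Jp.
rewrite (@derive_val _ _ _ _ _ _ _ (is_derive_frame_combination a b (w p) Ap)).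
move: (z_u z p) (t p.2) (n p.2) (n2 p) un un2 tn tn2 => x y N N2 un un2 tn tn2.
rewrite !(minkDl, minkZl) un un2 tn tn2.
by rewrite !mulr0 addr0 mulr0 !scale0r subr0.
Qed.

Lemma smooth_frame_combination a b :
  smooth_on (I `*` J) (fun q => a *: n q.2 + b *: n2 q).
Proof.
have sf1 := smooth_derive1 _ _ sf; have sg1 := smooth_derive1 _ _ sg.
apply: (separated_smooth _ _ _ _ oI oJ).
have -> : (fun q => a *: n q.2 + b *: n2 q) = (fun q => a *: (1 *: n q.2) +
    b *: (eps *: (g1 q.1 *: l q.2) + f1 q.1 *: e)).
  by apply/funext => q; rewrite scale1r /axial_normal scalerA.
apply: SeparatedSum; apply: SeparatedScale.
  exact: (SeparatedProduct I J (fun=> 1) n (smooth_cst _ _) sn).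
apply: SeparatedSum; first by apply: SeparatedScale; exact: SeparatedProduct.
exact: (SeparatedProduct I J f1 (fun=> e) sf1 (smooth_cst _ _)).
Qed.

(** Since n and n2 have tangential derivatives, the derivative of <b,n> along w
reduces to <D_w b, n>, which vanishes when b is parallel; likewise for n2. *)
Lemma normal_coordinates0 (x y d : 'rV[R]_4) :
  mink x x = eps -> mink x y = 0 -> mink y y = - eps ->
  (eps * mink d x) *: x - (eps * mink d y) *: y = 0 ->
  mink d x = 0 /\ mink d y = 0.
Proof.
move=> xx xy yy H; have := congr1 (mink^~ x) H; have := congr1 (mink^~ y) H => /=.
rewrite !mink0l !(minkDl, minkNl, minkZl) xx xy yy (minkC y) xy.
rewrite !mulr0 sub0r subr0 mulrN opprK !(mulrAC _ _ eps) !ee !mul1r.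
by move=> -> ->.
Qed.

Lemma ratio_of_collinear (N N2 B : 'rV[R]_4) (ka r a x y k : R) :
  mink N N = eps -> mink N N2 = 0 -> mink N2 N2 = - eps ->
  mink B N = x -> mink B N2 = y ->
  mink ((2 * r)^-1 *: ((eps * ka) *: N + a *: N2)) N2 = mink (k *: B) N2 ->
  mink ((2 * r)^-1 *: ((eps * ka) *: N + a *: N2)) N = mink (k *: B) N ->
  ka != 0 -> r != 0 -> a = - eps * (y / x) * ka.
Proof.
move=> nn nn2 n2n2 <- <-; rewrite !minkE (minkC N2) nn nn2 n2n2.
move: (mink B N) (mink B N2) => x' y'; rewrite !mulr0 add0r addr0 mulrAC ee mul1r.
move=> Hy Hx ka0 r0.
have ry : k * y' * (2 * r) = - (a * eps) by rewrite -Hy; field.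
have rx : k * x' * (2 * r) = ka by rewrite -Hx; field.
have kx0 : k * x' * (2 * r) != 0 by rewrite rx.
have [k0 x0] : k != 0 /\ x' != 0.
  by move: kx0; rewrite !mulf_eq0 !negb_or => /andP[/andP[-> ->] _].
transitivity (eps * eps * a); first by rewrite ee mul1r.
transitivity (- eps * (k * y' * (2 * r))); first by rewrite ry; ring.
by rewrite -rx; field.
Qed.

Lemma parallel_coefficients b : smooth_on (I `*` J) b ->
  (forall p, (I `*` J) p -> is_normal z p (b p)) ->
  parallel_section (I `*` J) z b ->
  exists x y, forall p, (I `*` J) p ->
    mink (b p) (n p.2) = x /\ mink (b p) (n2 p) = y.
Proof.
move=> sb nb pb.
have [_ itvI [u0 Iu0]] := up_I up; have [_ itvJ [v0 Jv0]] := md_J md.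
have A0 : (I `*` J) (u0, v0) by [].
have b_tangent p : (I `*` J) p -> mink (b p) (z_u z p) = 0 /\ mink (b p) (t p.2) = 0.
  move=> Ap; have [Ip _] := Ap; have [bu bv] := nb _ Ap.
  split; first exact: bu.
  have {bv} : mink (b p) (f p.1 *: t p.2) = 0 by rewrite -z_vE.
  move: (t p.2) (f_neq0 Ip) => y fp0.
  by rewrite minkZr => /eqP; rewrite mulf_eq0 (negPf fp0) => /eqP.
have db_normal w p : (I `*` J) p ->
    mink ('D_w b p) (n p.2) = 0 /\ mink ('D_w b p) (n2 p) = 0.
  move=> Ap; have [Ip Jp] := Ap.
  have [n2n2 tn2 nn2] := mink_axial_normal Ap.
  have [[_ _ nn] _] := md_frame md Jp.
  move: (pb _ (smooth_cst _ w) p Ap); rewrite /normal_connection normal_partE //.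
  exact: normal_coordinates0 nn nn2 n2n2.
have dA w p : (I `*` J) p -> is_derive p w b ('D_w b p).
  move=> Ap; apply: derivableP; apply: diff_derivable.
  exact: smooth_differentiable Ap.
have dx w p : (I `*` J) p -> is_derive p w (fun q => mink (b q) (n q.2)) 0.
  move=> Ap; have [_ bt] := b_tangent _ Ap; have [dbn _] := db_normal w _ Ap.
  apply: (is_derive_eq (is_derive_mink _ _ _ _ _ _ (dA w p Ap)
    (is_derive_spherical_normal w Ap))).
  by rewrite dbn minkZr bt mulr0 addr0.
have dy w p : (I `*` J) p -> is_derive p w (fun q => mink (b q) (n2 q)) 0.
  move=> Ap; have [bu bt] := b_tangent _ Ap; have [_ dbn2] := db_normal w _ Ap.
  apply: (is_derive_eq (is_derive_mink _ _ _ _ _ _ (dA w p Ap)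
    (is_derive_axial_normal w Ap))).
  rewrite dbn2; move: (z_u z p) (t p.2) bu bt => x y bu bt.
  by rewrite minkDr !minkZr bu bt !mulr0 !addr0.
exists (mink (b (u0, v0)) (n v0)), (mink (b (u0, v0)) (n2 (u0, v0))) => p Ap.
split.
  exact: (rectangle_cst I J (fun q => mink (b q) (n q.2)) itvI itvJ
    (dx _) (dx _) p (u0, v0) Ap A0).
exact: (rectangle_cst I J (fun q => mink (b q) (n2 q)) itvI itvJ
    (dy _) (dy _) p (u0, v0) Ap A0).
Qed.

Hypothesis kappa_neq0 : forall v, J v -> kappa v != 0.
Hypothesis nonnull : non_null_mean_curvature (I `*` J) z.

Lemma parallel_normal_bundle_ratio : parallel_normal_bundle (I `*` J) z ->
  exists m, forall u v, I u -> J v -> A u = m * kappa v.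
Proof.
move=> [b [eta [[sb _ frame] pb _]]].
have nb p : (I `*` J) p -> is_normal z p (b p) by move=> /frame[[]].
have [x [y xyP]] := parallel_coefficients sb nb pb.
exists (- eps * (y / x)) => u v Iu Jv; have Ap : (I `*` J) (u, v) by [].
have [n2n2 tn2 nn2] := mink_axial_normal Ap.
have [[_ _ nn] _] := md_frame md Jv.
have [bx b_y] := xyP _ Ap; have [_ _ _ [k]] := frame _ Ap.
rewrite mean_curvatureE // => Hk; move: (kappa_neq0 Jv) (f_neq0 Iu).
exact: (ratio_of_collinear nn nn2 n2n2 bx b_y
  (congr1 (mink^~ (n2 (u, v))) Hk) (congr1 (mink^~ (n v)) Hk)).
Qed.

(** When A = m kappa, H is a multiple of eps n + m n2, whose square norm
eps (1 - m^2) is nonzero as H is not null; the frame is obtained by normalizing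
it together with the orthogonal field m n + eps n2. *)
Lemma ratio_parallel_normal_bundle m :
  (forall u v, I u -> J v -> A u = m * kappa v) ->
  parallel_normal_bundle (I `*` J) z.
Proof.
move=> Am; have [_ _ [u0 Iu0]] := up_I up; have [_ _ [v0 Jv0]] := md_J md.
have HE p : (I `*` J) p -> mean_curvature z p =
    (kappa p.2 / (2 * f p.1)) *: (eps *: n p.2 + m *: n2 p).
  move=> Ap; have [Ip Jp] := Ap; rewrite mean_curvatureE //= (Am _ p.2) //.
  move: (n2 p) (n p.2) (kappa p.2) => x y k.
  by rewrite !scalerDr !scalerA; congr (_ *: _ + _ *: _); ring.
have norms a b a' b' p : (I `*` J) p ->
    mink (a *: n p.2 + b *: n2 p) (a' *: n p.2 + b' *: n2 p)
    = eps * (a * a' - b * b').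
  move=> Ap; have [Ip Jp] := Ap; have [n2n2 _ nn2] := mink_axial_normal Ap.
  have [[_ _ nn] _] := md_frame md Jp.
  move: (n2 p) (n p.2) n2n2 nn2 nn => x y xx yx yy.
  by rewrite !minkE (minkC x) yy yx xx; ring.
have m1 : 1 - m ^+ 2 != 0.
  have A0 : (I `*` J) (u0, v0) by [].
  have := nonnull A0; rewrite HE // minkZl minkZr; apply: contraNneq => m1.
  by rewrite norms // ee -expr2 m1 !mulr0.
pose rho := Num.sqrt `|1 - m ^+ 2|.
have rho0 : rho != 0 by rewrite sqrtr_eq0 -ltNge normr_gt0.
have rho2 : rho ^+ 2 = `|1 - m ^+ 2| by rewrite sqr_sqrtr.
have eps1 : `|eps| = 1.
  by apply/eqP; rewrite -(@eqrXn2 _ 2) // -normrX expr2 ee normr1 expr1n.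
exists (fun q => (rho^-1 * eps) *: n q.2 + (rho^-1 * m) *: n2 q).
exists (fun q => (rho^-1 * m) *: n q.2 + (rho^-1 * eps) *: n2 q).
split; [|exact: parallel_frame_combination|exact: parallel_frame_combination].
split; [exact: smooth_frame_combination|exact: smooth_frame_combination|].
move=> p Ap; have [Ip Jp] := Ap.
have [uu ut un un2] := mink_z_u Ap; have [_ tn2 _] := mink_axial_normal Ap.
have [_ [_ _ tn]] := md_frame md Jp.
have normal a b : is_normal z p (a *: n p.2 + b *: n2 p).
  split; last rewrite z_vE // minkZr; move: un un2 tn tn2;
    move: (z_u z p) (t p.2) (n p.2) (n2 p) => x y N N2 un un2 tn tn2.
    by rewrite minkC !(minkDr, minkZr) un un2 !mulr0 addr0.
  by rewrite minkC !(minkDr, minkZr) tn tn2 !(mulr0, addr0).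
have normb : mink ((rho^-1 * eps) *: n p.2 + (rho^-1 * m) *: n2 p)
    ((rho^-1 * eps) *: n p.2 + (rho^-1 * m) *: n2 p) = eps * ((1 - m ^+ 2) / rho ^+ 2).
  rewrite norms //; transitivity (eps * ((eps * eps - m ^+ 2) / rho ^+ 2)).
    by field.
  by rewrite ee.
split => //.
- split.
    by rewrite normb normrM eps1 rho2 normrM normfV normr_id divff ?mul1r ?normr_eq0.
  rewrite normb norms // -[RHS]mulrN; congr (_ * _).
  transitivity ((m ^+ 2 - eps * eps) / rho ^+ 2); first by field.
  by rewrite ee; field.
- by rewrite norms //; field.
- exists (rho * (kappa p.2 / (2 * f p.1))); rewrite HE //.
  move: (n2 p) (n p.2) (kappa p.2 / _) => x y k.
  by rewrite !scalerDr !scalerA; congr (_ *: _ + _ *: _); field.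
Qed.

End MeridianSurfaces.

(** * Classification *)

Section Classification.
Set Implicit Arguments.
Unset Strict Implicit.
Context {R : realType}.

(** A function of u proportional to a nonvanishing function of v: either the
factor is zero or both functions are constant. *)
Lemma parallel_normal_bundleP (eps : R) e I J f g l n :
  meridian_data eps e I J f g l n -> general_class I J f g l n ->
  non_null_mean_curvature (I `*` J) (meridian_surface e f g l) ->
  parallel_normal_bundle (I `*` J) (meridian_surface e f g l) <->
  (forall u, I u -> derive1 g u + f u * meridian_curvature f g u = 0) \/
  (const_spherical_curvature J l n /\ exists m, m != 0 /\
    forall u, I u -> derive1 g u + f u * meridian_curvature f g u = m).
Proof.
move=> md gc nonnull; have up := md_profile md.
have [_ _ [u0 Iu0]] := up_I up; have [_ _ [v0 Jv0]] := md_J md.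
have kappa_neq0 v : J v -> spherical_curvature l n v != 0.
  by move=> Jv; have := gc u0 v Iu0 Jv; rewrite mulf_eq0 negb_or => /andP[].
split=> [/(parallel_normal_bundle_ratio md kappa_neq0)[m Am]|].
  have [m0|m0] := eqVneq m 0.
    by left=> u Iu; rewrite (Am _ _ Iu Jv0) m0 mul0r.
  right; split; last first.
    exists (m * spherical_curvature l n v0); split; last first.
      by move=> u Iu; exact: Am.
    by rewrite mulf_neq0 ?kappa_neq0.
  exists (spherical_curvature l n v0); split; first exact: kappa_neq0.
  by move=> v Jv; apply: (mulfI m0); rewrite -(Am u0 v) // -(Am u0 v0).
case=> [A0|[[b [b0 kb]] [m [m0 Am]]]].
  apply: (ratio_parallel_normal_bundle md nonnull (m := 0)) => u v Iu _.
  by rewrite A0 // mul0r.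
apply: (ratio_parallel_normal_bundle md nonnull (m := m / b)) => u v Iu Jv.
by rewrite Am // kb // divfK.
Qed.

Lemma general_class_km (I J : set R) f g l n : J !=set0 -> general_class I J f g l n ->
  forall u, I u -> meridian_curvature f g u != 0.
Proof.
move=> [v Jv] gc u Iu; have := gc u v Iu Jv.
by rewrite mulf_eq0 negb_or => /andP[].
Qed.

Lemma elliptic_meridian_data I J f g (l n : R -> 'rV[R]_4) :
  elliptic_data I J f g l n -> meridian_data 1 (e_ 4) I J f g l n.
Proof.
case=> oI oJ sf sg sl sn f0 unit _ sphere _ nspan frame.
have perp x : in_span3 1 2 3 x -> mink x (e_ 4) = 0.
  by move=> /mink_in_span3; apply; rewrite mink_e // mulr0.
split=> //; first split=> //; first by rewrite mulr1.
- by move=> u Iu; rewrite mul1r unit.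
- by rewrite mink_e // mulr1 expr1.
- by move=> v Jv; case: (sphere v Jv) => /perp.
- by move=> v Jv; exact: perp (nspan v Jv).
Qed.

Lemma hyperbolic_meridian_data I J f g (l n : R -> 'rV[R]_4) :
  hyperbolic_data I J f g l n -> meridian_data (-1) (e_ 1) I J f g l n.
Proof.
case=> oI oJ sf sg sl sn f0 unit _ sphere _ nspan frame.
have perp x : in_span3 2 3 4 x -> mink x (e_ 1) = 0.
  by move=> /mink_in_span3; apply; rewrite mink_e // mulr0.
split=> //; first split=> //; first by rewrite mulrNN mulr1.
- by move=> u Iu; rewrite mulN1r opprK unit.
- by rewrite mink_e // mulr1 opprK.
- by move=> v Jv; case: (sphere v Jv) => /perp.
- by move=> v Jv; exact: perp (nspan v Jv).
Qed.

Lemma sign_sqrt_quotient (y x r : R) : 0 < x -> (x * y) ^+ 2 = r ->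
  0 <= r /\ `|y| = Num.sqrt r / x.
Proof.
move=> x0 <-; split; first exact: sqr_ge0.
by rewrite sqrtr_sqr normrM (gtr0_norm x0) mulrC mulKf ?gt_eqF.
Qed.

Lemma sqr_sign_sqrt (s : bool) (y x r : R) : 0 < x -> 0 <= r ->
  y = (-1) ^+ s * (Num.sqrt r / x) -> (x * y) ^+ 2 = r.
Proof.
move=> x0 r0 ->; rewrite mulrCA exprMn sqrr_sign mul1r.
by rewrite mulrC divfK ?gt_eqF // sqr_sqrtr.
Qed.

Lemma elliptic_radicandE a c t :
  elliptic_radicand a c t = t ^+ 2 + 1 * (a * t + 1 * c) ^+ 2 :> R.
Proof. by rewrite /elliptic_radicand; ring. Qed.

Lemma hyperbolic_radicandE a c t :
  hyperbolic_radicand a c t = t ^+ 2 + (-1) * (a * t + (-1) * c) ^+ 2 :> R.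
Proof. by rewrite /hyperbolic_radicand; ring. Qed.

Lemma elliptic_case_aP I J f g (l n : R -> 'rV[R]_4) :
  elliptic_data I J f g l n -> (forall u, I u -> meridian_curvature f g u != 0) ->
  (forall u, I u -> derive1 g u + f u * meridian_curvature f g u = 0) <->
  elliptic_case_a I f g.
Proof.
move=> ed km0; have up := md_profile (elliptic_meridian_data ed).
have g1_ge0 u : I u -> 0 <= derive1 g u.
  by move=> Iu; rewrite (ell_sign ed) // sqrtr_ge0.
apply: (iff_trans (profile_logarithmicP up km0 g1_ge0)).
by split=> -[a [c [d [s1 [s2 b]]]]]; exists a, c, d, s1, s2;
  move: b; rewrite mul1r subr_gt0.
Qed.

Lemma hyperbolic_case_aP I J f g (l n : R -> 'rV[R]_4) :
  hyperbolic_data I J f g l n -> (forall u, I u -> meridian_curvature f g u != 0) ->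
  (forall u, I u -> derive1 g u + f u * meridian_curvature f g u = 0) <->
  hyperbolic_case_a I f g.
Proof.
move=> hd km0; have up := md_profile (hyperbolic_meridian_data hd).
have g1_ge0 u : I u -> 0 <= derive1 g u.
  by move=> Iu; rewrite (hyp_sign hd) // sqrtr_ge0.
apply: (iff_trans (profile_logarithmicP up km0 g1_ge0)).
by split=> -[a [c [d [s1 [s2 b]]]]]; exists a, c, d, s1, s2;
  move: b; rewrite mulN1r opprB subr_gt0.
Qed.

(** Here |f'| >= 1, so f' has a constant sign on I. *)
Lemma elliptic_case_bP I J f g (l n : R -> 'rV[R]_4) :
  elliptic_data I J f g l n -> (forall u, I u -> meridian_curvature f g u != 0) ->
  (const_spherical_curvature J l n /\ exists m, m != 0 /\
    forall u, I u -> derive1 g u + f u * meridian_curvature f g u = m) <->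
  elliptic_case_b I J f g l n.
Proof.
move=> ed km0; have up := md_profile (elliptic_meridian_data ed).
have g1_ge0 u : I u -> 0 <= derive1 g u.
  by move=> Iu; rewrite (ell_sign ed) // sqrtr_ge0.
have [_ itvI I0] := up_I up.
have df1 u : I u -> derivable (derive1 f) u 1.
  move=> Iu; apply: ex_derive.
  exact: smooth_is_derive (smooth_derive1 _ _ (up_f up)) Iu.
have f1_neq0 u : I u -> derive1 f u != 0.
  move=> Iu; apply/negP => /eqP f1u; have := up_unit up Iu; rewrite f1u mul1r.
  by have := sqr_ge0 (derive1 g u); lra.
have [s f1s] := interval_sign_cst I (derive1 f) itvI df1 f1_neq0 I0.
split=> -[kc H]; split=> //.
  have [a [c [a0 ode]]] := (profile_affineP up km0 g1_ge0).1 H.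
  exists a, c, s; split=> // u Iu; have := ode u Iu; rewrite -elliptic_radicandE.
  move=> /(sign_sqrt_quotient (ell_f_gt0 ed Iu))[q0 f1E].
  by split; [|rewrite -f1E; exact: f1s|exact: ell_sign ed _ Iu].
have [a [c [s' [a0 ode]]]] := H.
apply/(profile_affineP up km0 g1_ge0); exists a, c; split=> // u Iu.
have [q0 f1E _] := ode u Iu; rewrite -elliptic_radicandE.
exact: sqr_sign_sqrt (ell_f_gt0 ed Iu) q0 f1E.
Qed.

Lemma hyperbolic_case_bP I J f g (l n : R -> 'rV[R]_4) :
  hyperbolic_data I J f g l n -> (forall u, I u -> meridian_curvature f g u != 0) ->
  (const_spherical_curvature J l n /\ exists m, m != 0 /\
    forall u, I u -> derive1 g u + f u * meridian_curvature f g u = m) <->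
  hyperbolic_case_b I J f g l n.
Proof.
move=> hd km0; have up := md_profile (hyperbolic_meridian_data hd).
have g1_ge0 u : I u -> 0 <= derive1 g u.
  by move=> Iu; rewrite (hyp_sign hd) // sqrtr_ge0.
split=> -[kc H]; split=> //.
  have [a [c [a0 ode]]] := (profile_affineP up km0 g1_ge0).1 H.
  exists a, c, (fun u => derive1 f u < 0); split=> // u Iu.
  have := ode u Iu; rewrite -hyperbolic_radicandE.
  move=> /(sign_sqrt_quotient (hyp_f_gt0 hd Iu))[q0 f1E].
  by split; [|rewrite -f1E -numEsign|exact: hyp_sign hd _ Iu].
have [a [c [s [a0 ode]]]] := H.
apply/(profile_affineP up km0 g1_ge0); exists a, c; split=> // u Iu.
have [q0 f1E _] := ode u Iu; rewrite -hyperbolic_radicandE.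
exact: sqr_sign_sqrt (hyp_f_gt0 hd Iu) q0 f1E.
Qed.

End Classification.

Theorem theorem8p1 (R : realType) :
  (forall (I J : set R) (f g : R -> R) (l n : R -> 'rV[R]_4),
     elliptic_data I J f g l n ->
     general_class I J f g l n ->
     non_null_mean_curvature (I `*` J) (elliptic_surface f g l) ->
     (parallel_normal_bundle (I `*` J) (elliptic_surface f g l) <->
      elliptic_case_a I f g \/ elliptic_case_b I J f g l n)) /\
  (forall (I J : set R) (f g : R -> R) (l n : R -> 'rV[R]_4),
     hyperbolic_data I J f g l n ->
     general_class I J f g l n ->
     non_null_mean_curvature (I `*` J) (hyperbolic_surface f g l) ->
     (parallel_normal_bundle (I `*` J) (hyperbolic_surface f g l) <->
      hyperbolic_case_a I f g \/ hyperbolic_case_b I J f g l n)).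
Proof.
split=> I J f g l n data gc nonnull.
  have md := elliptic_meridian_data data.
  have [_ _ J0] := md_J md; have km0 := general_class_km J0 gc.
  have [] := parallel_normal_bundleP md gc nonnull.
  by rewrite (propext (elliptic_case_aP data km0)) (propext (elliptic_case_bP data km0)).
have md := hyperbolic_meridian_data data.
have [_ _ J0] := md_J md; have km0 := general_class_km J0 gc.
have [] := parallel_normal_bundleP md gc nonnull.
by rewrite (propext (hyperbolic_case_aP data km0)) (propext (hyperbolic_case_bP data km0)).
Qed.
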